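(* Let $\mathcal{X}$ and $\mathcal{Y}$ be countably generated LFCM spaces, and let $C_X$ be a coarse $\mathcal{X}$-module and $C_Y$ a coarse $\mathcal{Y}$-module. Suppose $U\colon H_{C_X}\to H_{C_Y}$ is a unitary such that $\operatorname{Ad}_U$ restricts to a $*$-isomorphism between the algebras of approximable operators on $C_X$ and $C_Y$, respectively. Then, for any $\delta\in(0,1)$, there exist sufficiently large sets $F\in\mathcal{E}^Y$ and $E\in\mathcal{E}^X$ such that the approximate relation $$f^U_{\delta,F,E}\colon\operatorname{dom}_1(C_X)\to\operatorname{dom}_1(C_Y)$$ is a coarse equivalence, with inverse $f^{U^*}_{\delta,E,F}$.
   Context: A coarse structure on a set $X$ is a family $\mathcal{E}^X$ of subsets of $X\times X$ (entourages) containing the diagonal and closed under subsets, finite unions, transposes and compositions; it is countably generated if it is the smallest coarse structure containing some countable family. $A\subset X$ is $E$-bounded if $A\times A\subset E$, bounded if it is $E$-bounded for some entourage $E$. With $E[A]=\{x\mid\exists a\in A:(x,a)\in E\}$, $A\prec B$ means $A\subset E[B]$ for some $E\in\mathcal{E}^X$; $A\asymp B$ means $A\prec B$ and $B\prec A$. A relation $R\subset Y\times X$ (from $X$ to $Y$) between coarse spaces is controlled if $R\circ E\circ R^T\in\mathcal{E}^Y$ for all $E\in\mathcal{E}^X$. It is a coarse equivalence if $R$ and $R^T$ are controlled, $\pi_X(R)\asymp X$ and $\pi_Y(R)\asymp Y$, where $\pi_X,\pi_Y$ are the coordinate projections; such a relation is asymptotically equivalent (in $Y\times X$ with the product coarse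 structure) to the graph of a coarse equivalence map, and an inverse is a relation from $Y$ to $X$ representing the inverse closeness class. A locally finite coarse measurable (LFCM) space is a triple $\mathcal{X}=(X,\mathcal{E}^X,\mathfrak{A}^X)$ with $(X,\mathcal{E}^X)$ a coarse space and $\mathfrak{A}^X$ a Boolean algebra of subsets of $X$ (the measurable sets) for which there is a partition $\{A_i\}_{i\in I}$ of $X$ (a discrete partition) by measurable sets such that every bounded set meets finitely many $A_i$, all $A_i$ are $E$-bounded for a common entourage $E$, and $B\in\mathfrak{A}^X$ iff $B\cap A_i\in\mathfrak{A}^X$ for all $i$. A discrete partition is fixed and $E^X_{\mathrm{disc}}=\bigsqcup_iA_i\times A_i$. The space is countably generated if $\mathcal{E}^X$ is. A coarse $\mathcal{X}$-module $C$ is a Hilbert space $H_C$ with a (unital) representation $A\mapsto\mathbb{1}^C_A$ of $\mathfrak{A}^X$ by projections on $H_C$ such that the span of $\{\mathbb{1}^C_AH_C\mid A\in\mathfrak{A}^X\text{ is }E^X_{\mathrm{disc}}\text{-bounded}\}$ is dense. The support of a bounded operator $t$ on $H_C$ is $\bigcup\{B\times A\mid A,B\in\mathfrak{A}^X\ E^X_{\mathrm{disc}}\text{-bounded},\ \mathbb{1}^C_Bt\mathbb{1}^C_A\ne0\}$; $t$ has controlled propagation if its support is an entourage, and is approximable if it is a norm limit of controlled propagation operators. The faithfulness domain is $\operatorname{dom}_1(C)=\bigcup\{A\in\mathfrak{A}^X\mid A\ E^X_{\mathrm{disc}}\text{-bounded},\ \mathbb{1}^C_A\ne0\}$; it is a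 union of elements of the discrete partition and is regarded as an LFCM space with the coarse and measurable structures induced from $\mathcal{X}$; $C$ is then naturally a module over it. Approximate relation, for $C_X$, $C_Y$ regarded as modules over their faithfulness domains: $f^U_{\delta,F,E}=\bigcup\{B\times A\mid B\subset\operatorname{dom}_1(C_Y)\text{ measurable, }F\text{-bounded},\ A\subset\operatorname{dom}_1(C_X)\text{ measurable, }E\text{-bounded},\ \|\mathbb{1}_B^{C_Y}U\mathbb{1}_A^{C_X}\|>\delta\}$, and similarly $f^{U^*}_{\delta,E,F}$ with the roles of the two spaces exchanged. *)

(* Defs.v *)
From HB Require Import structures.
From mathcomp Require Import all_boot all_order all_algebra.
From mathcomp Require Import complex.
From mathcomp Require Import all_classical all_reals all_analysis.

Set Implicit Arguments.
Unset Strict Implicit.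
Unset Printing Implicit Defensive.

Import Order.TTheory GRing.Theory Num.Theory.
Import numFieldNormedType.Exports.

Local Open Scope classical_set_scope.
Local Open Scope ring_scope.
Local Open Scope relation_scope.

(* The library's [S \; R] is [(x, z) | exists2 y, R (x, y) & S (y, z)]: read as
   sets of pairs, with R o S = [(x, z) | exists y, (x, y) in R and (y, z) in S],
   it is R o S.  In particular R o E o R^T is written [R^-1 \; E \; R].
   A relation from X to Y is a subset of Y * X, as for the graph [(f x, x)]. *)

Record is_coarse_structure (X : Type) (E : set (set (X * X))) : Prop := {
  coarse_diag : E diagonal ;
  coarse_subset : forall A B, A `<=` B -> E B -> E A ;
  coarse_setU : forall A B, E A -> E B -> E (A `|` B) ;
  coarse_transpose : forall A, E A -> E A^-1 ;
  coarse_comp : forall A B, E A -> E B -> E (B \; A) }.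

Record coarseSpace := CoarseSpace {
  coarse_sort :> Type ;
  coarse_entourage : set (set (coarse_sort * coarse_sort)) ;
  coarseP : is_coarse_structure coarse_entourage }.

Definition countably_generated (X : coarseSpace) : Prop :=
  exists2 G : set (set (X * X)), countable G &
    @coarse_entourage X = smallest (@is_coarse_structure X) G.

Definition bounded_by (X : Type) (E : set (X * X)) (A : set X) : Prop :=
  A `*` A `<=` E.

Definition coarse_bounded (X : coarseSpace) (A : set X) : Prop :=
  exists2 E, coarse_entourage E & bounded_by E A.

Definition thickening (X : Type) (E : set (X * X)) (A : set X) : set X :=
  [set x | exists2 a, A a & E (x, a)].

Definition coarsely_contained (X : coarseSpace) (A B : set X) : Prop :=
  exists2 E, coarse_entourage E & A `<=` thickening E B.

Definition asymptotic (X : coarseSpace) (A B : set X) : Prop :=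
  coarsely_contained A B /\ coarsely_contained B A.

Definition sub_entourage (X : coarseSpace) (D : set X) : set (set (D * D)) :=
  [set E | coarse_entourage ((fun p : D * D => (val p.1, val p.2)) @` E)].

Lemma sub_coarseP (X : coarseSpace) (D : set X) :
  is_coarse_structure (@sub_entourage X D).
Proof.
have [cd cs cU ct cc] := coarseP X; split.
- by apply: cs cd => _ [[x y] /diagonalP -> <-].
- by move=> A B AB; apply: cs; exact: image_subset.
- by move=> A B EA EB; rewrite /sub_entourage /= image_setU; exact: cU.
- move=> A EA; apply: cs (ct _ EA) => _ [[x y] /= Axy <-] /=.
  by exists (y, x).
- move=> A B EA EB; apply: cs (cc _ _ EA EB) => _ [[x y] /= [z Axz Bzy] <-] /=.
  by exists (val z); [exists (x, z)|exists (z, y)].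
Qed.

Definition sub_coarse (X : coarseSpace) (D : set X) : coarseSpace :=
  CoarseSpace (@sub_coarseP X D).

Definition prod_entourage (Y X : coarseSpace) :
    set (set ((Y * X) * (Y * X))) :=
  [set E | coarse_entourage ((fun p : (Y * X) * (Y * X) => (p.1.1, p.2.1)) @` E)
        /\ coarse_entourage ((fun p : (Y * X) * (Y * X) => (p.1.2, p.2.2)) @` E)].

Lemma prod_coarseP (Y X : coarseSpace) :
  is_coarse_structure (@prod_entourage Y X).
Proof.
have [cd cs cU ct cc] := coarseP Y; have [cd' cs' cU' ct' cc'] := coarseP X.
split.
- split; first by apply: cs cd => _ [[x y] /diagonalP -> <-].
  by apply: cs' cd' => _ [[x y] /diagonalP -> <-].
- move=> A B AB [E1 E2]; split; [apply: cs E1|apply: cs' E2];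
    exact: image_subset.
- move=> A B [A1 A2] [B1 B2]; rewrite /prod_entourage /= !image_setU.
  by split; [exact: cU|exact: cU'].
- move=> A [A1 A2]; split.
    by apply: cs (ct _ A1) => _ [[x y] /= Axy <-] /=; exists (y, x).
  by apply: cs' (ct' _ A2) => _ [[x y] /= Axy <-] /=; exists (y, x).
- move=> A B [A1 A2] [B1 B2]; split.
    apply: cs (cc _ _ A1 B1) => _ [[x y] /= [z Axz Bzy] <-] /=.
    by exists z.1; [exists (x, z)|exists (z, y)].
  apply: cs' (cc' _ _ A2 B2) => _ [[x y] /= [z Axz Bzy] <-] /=.
  by exists z.2; [exists (x, z)|exists (z, y)].
Qed.

Definition prod_coarse (Y X : coarseSpace) : coarseSpace :=
  CoarseSpace (@prod_coarseP Y X).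

Section relations.
Variables X Y : coarseSpace.

Definition controlled (r : set (Y * X)) : Prop :=
  forall E, coarse_entourage E -> coarse_entourage (r^-1 \; E \; r).

Definition closeness (r s : set (Y * X)) : Prop :=
  @asymptotic (prod_coarse Y X) r s.

Definition graph_of (f : X -> Y) : set (Y * X) := [set yx | yx.1 = f yx.2].

End relations.

Definition coarse_equivalence (X Y : coarseSpace) (r : set (Y * X)) : Prop :=
  [/\ @controlled X Y r, @controlled Y X r^-1,
      @asymptotic X (snd @` r) [set: X] & @asymptotic Y (fst @` r) [set: Y]].

(* r and s represent the closeness classes of mutually inverse coarse maps. *)
Definition coarse_inverse (X Y : coarseSpace)
    (r : set (Y * X)) (s : set (X * Y)) : Prop :=
  exists f : X -> Y, exists g : Y -> X,
    [/\ controlled (graph_of f), controlled (graph_of g),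
        closeness r (graph_of f) & closeness s (graph_of g)] /\
    closeness (graph_of (g \o f)) (graph_of id) /\
    closeness (graph_of (f \o g)) (graph_of id).

Record is_boolean_algebra (X : Type) (A : set (set X)) : Prop := {
  boolalg_set0 : A set0 ;
  boolalg_setC : forall B, A B -> A (~` B) ;
  boolalg_setU : forall B C, A B -> A C -> A (B `|` C) }.

Definition disc_entourage (X I : Type) (P : I -> set X) : set (X * X) :=
  \bigcup_i (P i `*` P i).

(* An LFCM space together with the choice of a discrete partition. *)
Record lfcmSpace := LfcmSpace {
  lfcm_coarse :> coarseSpace ;
  msets : set (set lfcm_coarse) ;
  msetsP : is_boolean_algebra msets ;
  disc_index : Type ;
  disc : disc_index -> set lfcm_coarse ;
  disc_partition : partition [set: disc_index] disc [set: lfcm_coarse] ;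
  disc_msets : forall i, msets (disc i) ;
  disc_locally_finite : forall B : set lfcm_coarse, coarse_bounded B ->
    finite_set [set i | B `&` disc i !=set0] ;
  disc_bounded : exists2 E, coarse_entourage E &
    forall i, bounded_by E (disc i) ;
  disc_local : forall B, msets B <-> forall i, msets (B `&` disc i) }.

Definition Edisc (X : lfcmSpace) : set (X * X) := disc_entourage (@disc X).

(* Complex Hilbert spaces; the form is linear in its first argument. *)
Record hilbertSpace (R : realType) := HilbertSpace {
  hilbert_sort :> completeNormedModType R[i] ;
  hdot : {dot hilbert_sort for @Num.conj R[i]} ;
  hdotE : forall x : hilbert_sort, `|x| ^+ 2 = hdot x x }.

Definition linear_span (K : nzRingType) (V : lmodType K) (S : set V) : set V :=
  smallest (fun W : set V =>
    W 0 /\ forall a u v, W u -> W v -> W (a *: u + v)) S.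

Section operators.
Variable R : realType.

Definition bounded_operator (H K : hilbertSpace R) (t : H -> K) : Prop :=
  linear t /\ exists M : R[i], forall x, `|t x| <= M * `|x|.

(* `|x| lies in R[i], hence the real part. *)
Definition opnorm (H K : hilbertSpace R) (t : H -> K) : R :=
  sup [set complex.Re `|t x| | x in [set x : H | `|x| <= 1]].

Definition is_adjoint (H K : hilbertSpace R) (t : H -> K) (s : K -> H) : Prop :=
  forall x y, hdot K (t x) y = hdot H x (s y).

Definition is_projection (H : hilbertSpace R) (p : H -> H) : Prop :=
  [/\ bounded_operator p, p \o p = p & is_adjoint p p].

(* u is unitary and us is its adjoint. *)
Definition unitary_operator (H K : hilbertSpace R) (u : H -> K) (us : K -> H) : Prop :=
  [/\ bounded_operator u, bounded_operator us, is_adjoint u us,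
      us \o u = id & u \o us = id].

Definition Ad (H K : hilbertSpace R) (u : H -> K) (us : K -> H)
  (t : H -> H) : K -> K := u \o t \o us.

Definition restricts_to_star_iso (H K : hilbertSpace R)
    (A : set (H -> H)) (B : set (K -> K)) (phi : (H -> H) -> (K -> K)) : Prop :=
  [/\ set_bij A B phi,
      forall (a : R[i]) t s, A t -> A s ->
        phi (a \*: t \+ s) = a \*: phi t \+ phi s,
      forall t s, A t -> A s -> phi (t \o s) = phi t \o phi s &
      forall t ts, A t -> A ts -> is_adjoint t ts ->
        is_adjoint (phi t) (phi ts)].

End operators.

Record coarseModule (R : realType) (X : lfcmSpace) := CoarseModule {
  cmod_space :> hilbertSpace R ;
  chi : set X -> cmod_space -> cmod_space ;
  chi_projection : forall A, msets A -> is_projection (chi A) ;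
  chi_setT : chi setT = id ;
  chi_setI : forall A B, msets A -> msets B ->
    chi (A `&` B) = chi A \o chi B ;
  chi_setU : forall A B, msets A -> msets B -> A `&` B = set0 ->
    chi (A `|` B) = chi A \+ chi B ;
  chi_dense : dense (linear_span
    (\bigcup_(A in [set A | msets A /\ bounded_by (@Edisc X) A])
       range (chi A))) }.

Arguments chi {R X} c A x : rename.

Section modules.
Variables (R : realType) (X : lfcmSpace) (C : coarseModule R X).

Definition op_support (t : C -> C) : set (X * X) :=
  \bigcup_(BA in [set BA : set X * set X |
      [/\ msets BA.1, msets BA.2,
          bounded_by (@Edisc X) BA.1, bounded_by (@Edisc X) BA.2 &
          chi C BA.1 \o t \o chi C BA.2 <> (fun=> 0)]])
    (BA.1 `*` BA.2).

Definition controlled_propagation (t : C -> C) : Prop :=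
  bounded_operator t /\ coarse_entourage (op_support t).

Definition approximable : set (C -> C) :=
  [set t | bounded_operator t /\
    forall e : R, 0 < e ->
      exists2 s, controlled_propagation s & opnorm (t \- s) < e].

Definition dom1 : set X :=
  \bigcup_(A in [set A | [/\ msets A, bounded_by (@Edisc X) A &
                             chi C A <> (fun=> 0)]]) A.

End modules.

(* dom1 is itself measurable, so the measurable subsets of the LFCM space dom1
   are the measurable sets of the ambient space contained in dom1. *)
Definition approx_relation (R : realType) (X Y : lfcmSpace)
    (CX : coarseModule R X) (CY : coarseModule R Y) (u : CX -> CY) (delta : R)
    (F : set (Y * Y)) (E : set (X * X)) :
    set (sub_coarse (dom1 CY) * sub_coarse (dom1 CX)) :=
  [set yx | (\bigcup_(BA in [set BA : set Y * set X |
      [/\ msets BA.1 /\ msets BA.2,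
          BA.1 `<=` dom1 CY /\ BA.2 `<=` dom1 CX,
          bounded_by F BA.1, bounded_by E BA.2 &
          delta < opnorm (chi CY BA.1 \o u \o chi CX BA.2)]])
    (BA.1 `*` BA.2)) (val yx.1, val yx.2)].

(* Main.v *)
(* Controlled propagation is only used through quasi-locality: an approximable
   operator has small matrix coefficients between vectors supported on sets that
   are far apart. Cofinal sequences of entourages and a gliding hump turn this
   into uniform estimates: if [w] and [w'] are supported on bounded sets that
   are far apart in [Y], then [U^* w] and [U^* w'] cannot both have large
   components on a common bounded set of [X], with a distance depending only on
   the size of the sets. This makes the approximate relations of [U] and [U^*]
   controlled, and they are transposes of each other.
   For their projections to be onto, let [v] be a unit vector on a disc. The
   operators [U^* 1_S U] are quasi-local uniformly in the union of discs [S], so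
   they keep [v] near its disc. A choice of signs then shows that most of the
   mass of [U v] sits on discs [B] whose components [1_B U v] are mostly mapped
   by [U^*] near that disc; by the first estimate these [B] form a bounded set. *)

Require Import Defs.
From mathcomp Require Import all_boot all_order all_algebra.
From mathcomp Require Import complex.
From mathcomp Require Import all_classical all_reals all_analysis.
From mathcomp Require Import lra ring.

Set Implicit Arguments.
Unset Strict Implicit.
Unset Printing Implicit Defensive.

Import Order.TTheory GRing.Theory Num.Theory.
Import numFieldNormedType.Exports.

Local Open Scope classical_set_scope.
Local Open Scope ring_scope.

(** * Linear maps given as plain functions *)

Section linear_maps.
Variables (K : pzRingType) (V W : lmodType K) (t : V -> W).
Hypothesis tl : linear t.

Lemma linear_add x y : t (x + y) = t x + t y.
Proof. by rewrite -[x]scale1r tl !scale1r. Qed.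

Lemma linear_zero : t 0 = 0.
Proof. by apply: (addrI (t 0)); rewrite -linear_add !addr0. Qed.

Lemma linear_scale a x : t (a *: x) = a *: t x.
Proof. by rewrite -[a *: x]addr0 tl linear_zero addr0. Qed.

Lemma linear_bigsum (I : Type) (r : seq I) (F : I -> V) :
  t (\sum_(i <- r) F i) = \sum_(i <- r) t (F i).
Proof. exact: (big_morph _ linear_add linear_zero). Qed.

End linear_maps.

(** * Real inner product and real norm of a complex Hilbert space *)

Section hilbert.
Variables (R : realType) (H : hilbertSpace R).
Implicit Types (x y z : H) (a : R[i]) (r : R).

(** Estimates are made over [R] through real parts, since [R[i]] is only partially ordered. *)
Definition rdot x y : R := complex.Re (hdot H x y).
Definition nrm x : R := complex.Re `|x|.

Lemma nrm_ge0 x : 0 <= nrm x.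
Proof. by have := normr_ge0 x; rewrite lecE => /andP[]. Qed.

Lemma normE x : `|x| = (nrm x)%:C%C.
Proof. by rewrite /nrm RRe_real// ger0_real. Qed.

Lemma hdotxx x : hdot H x x = (nrm x ^+ 2)%:C%C.
Proof. by rewrite -hdotE normE rmorphXn. Qed.

Lemma hdotC x y : hdot H x y = Num.conj (hdot H y x).
Proof. by have := hermC (hdot H) x y; rewrite expr0 mul1r. Qed.

Lemma rdotC x y : rdot x y = rdot y x.
Proof. by rewrite /rdot hdotC; case: (hdot H y x). Qed.

Lemma rdotDl x y z : rdot (x + y) z = rdot x z + rdot y z.
Proof. by rewrite /rdot linearDl raddfD. Qed.

Lemma rdotNl x y : rdot (- x) y = - rdot x y.
Proof. by rewrite /rdot linearNl raddfN. Qed.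

Lemma rdotDr x y z : rdot x (y + z) = rdot x y + rdot x z.
Proof. by rewrite ![rdot x _]rdotC rdotDl. Qed.

Lemma rdotNr x y : rdot x (- y) = - rdot x y.
Proof. by rewrite ![rdot x _]rdotC rdotNl. Qed.

Lemma rdotZl r x y : rdot (r%:C%C *: x) y = r * rdot x y.
Proof. by rewrite /rdot linearZl /=; case: (hdot H x y) => p q /=; ring. Qed.

Lemma rdot0l y : rdot 0 y = 0.
Proof. by rewrite /rdot linear0l. Qed.

Lemma rdot0r y : rdot y 0 = 0.
Proof. by rewrite rdotC rdot0l. Qed.

Lemma rdotxx x : rdot x x = nrm x ^+ 2.
Proof. by rewrite /rdot hdotxx. Qed.

Lemma nrm0 : nrm 0 = 0.
Proof. by rewrite /nrm normr0. Qed.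

Lemma nrm_eq0 x : nrm x = 0 -> x = 0.
Proof. by move=> h; apply/eqP; rewrite -normr_eq0 normE h. Qed.

Lemma nrmD x y : nrm (x + y) <= nrm x + nrm y.
Proof. by have := ler_normD x y; rewrite !normE -raddfD/= lecR. Qed.

Lemma nrmN x : nrm (- x) = nrm x.
Proof. by rewrite /nrm normrN. Qed.

Lemma nrmB x y : nrm (x - y) <= nrm x + nrm y.
Proof. by rewrite -(nrmN y) nrmD. Qed.

Lemma nrmZ r x : 0 <= r -> nrm (r%:C%C *: x) = r * nrm x.
Proof.
move=> r0; rewrite /nrm normrZ normc_def /= expr0n/= addr0 sqrtr_sqr ger0_norm//.
by rewrite normE /= mul0r subr0.
Qed.

Lemma nrm_sqrD x y : nrm (x + y) ^+ 2 = nrm x ^+ 2 + 2 * rdot x y + nrm y ^+ 2.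
Proof. by rewrite -!rdotxx !(rdotDl, rdotDr) (rdotC y x); ring. Qed.

Lemma nrm_sqrB x y : nrm (x - y) ^+ 2 = nrm x ^+ 2 - 2 * rdot x y + nrm y ^+ 2.
Proof. by rewrite nrm_sqrD rdotNr nrmN; ring. Qed.

(** Cauchy-Schwarz, read off from the squared triangle inequality. *)
Lemma rdot_le x y : rdot x y <= nrm x * nrm y.
Proof.
have := nrmD x y; rewrite -ler_sqr ?nnegrE ?addr_ge0 ?nrm_ge0//.
by rewrite nrm_sqrD => h; nra.
Qed.

Lemma rdot_abs x y : `|rdot x y| <= nrm x * nrm y.
Proof.
by rewrite ler_norml rdot_le andbT lerNl -rdotNl -(nrmN x) rdot_le.
Qed.

Lemma rdot_abs1 x y : nrm y <= 1 -> `|rdot x y| <= nrm x.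
Proof.
move=> y1; apply: le_trans (rdot_abs _ _) _.
by rewrite -[leRHS]mulr1 ler_wpM2l// nrm_ge0.
Qed.

Lemma nrm_parallelogram x y :
  nrm (x + y) ^+ 2 + nrm (x - y) ^+ 2 = 2 * (nrm x ^+ 2 + nrm y ^+ 2).
Proof. by rewrite nrm_sqrD nrm_sqrB; ring. Qed.

End hilbert.

Arguments rdot {R H}.
Arguments nrm {R H}.

(** * Boundedness and the operator norm *)

Section bounded_operators.
Variable R : realType.

Lemma bounded_nrm (H K : hilbertSpace R) (t : H -> K) : bounded_operator t ->
  exists2 M : R, 0 <= M & forall x, nrm (t x) <= M * nrm x.
Proof.
move=> [_ [M hM]]; exists (Num.max 0 (complex.Re M)) => [|x].
  by rewrite le_max lexx.
have := hM x; rewrite !normE.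
case: M {hM} => p q; rewrite lecE /= => /andP[_]; rewrite mulr0 subr0 => h.
by rewrite (le_trans h)// ler_wpM2r ?nrm_ge0// le_max lexx orbT.
Qed.

Lemma bounded_of_nrm (H K : hilbertSpace R) (t : H -> K) (M : R) : linear t ->
  (forall x, nrm (t x) <= M * nrm x) -> bounded_operator t.
Proof.
move=> tl hM; split=> //; exists M%:C%C => x.
by rewrite !normE -rmorphM/= lecR.
Qed.

Lemma bounded_comp (H K L : hilbertSpace R) (t : K -> L) (s : H -> K) :
  bounded_operator t -> bounded_operator s -> bounded_operator (t \o s).
Proof.
move=> bt bs; have [[tl _] [sl _]] := (bt, bs).
have [M M0 hM] := bounded_nrm bt; have [N N0 hN] := bounded_nrm bs.
apply: (@bounded_of_nrm _ _ _ (M * N)) => [a x y /=|x /=]; first by rewrite sl tl.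
by rewrite (le_trans (hM _))// -mulrA ler_wpM2l.
Qed.

Lemma bounded_sub (H K : hilbertSpace R) (t s : H -> K) :
  bounded_operator t -> bounded_operator s -> bounded_operator (t \- s).
Proof.
move=> bt bs; have [[tl _] [sl _]] := (bt, bs).
have [M M0 hM] := bounded_nrm bt; have [N N0 hN] := bounded_nrm bs.
apply: (@bounded_of_nrm _ _ _ (M + N)) => [a x y /=|x /=].
  by rewrite sl tl scalerBr opprD addrACA.
by rewrite (le_trans (nrmB _ _))// mulrDl lerD.
Qed.

Lemma opnorm_ubound (H K : hilbertSpace R) (t : H -> K) : bounded_operator t ->
  has_ubound [set complex.Re `|t x| | x in [set x : H | `|x| <= 1]].
Proof.
move=> /bounded_nrm[M M0 hM]; exists M => _ [x /= x1 <-].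
move: x1; rewrite normE -[1]/((1 : R)%:C%C) lecR => x1.
by rewrite (le_trans (hM x))// -[leRHS]mulr1 ler_wpM2l.
Qed.

Lemma opnorm_ge (H K : hilbertSpace R) (t : H -> K) x : bounded_operator t ->
  nrm x <= 1 -> nrm (t x) <= opnorm t.
Proof.
move=> bt x1; apply: ub_le_sup; first exact: opnorm_ubound.
by exists x => //=; rewrite normE -[1]/((1 : R)%:C%C) lecR.
Qed.

Lemma opnorm_gt (H K : hilbertSpace R) (t : H -> K) r : r < opnorm t ->
  exists2 x, nrm x <= 1 & r < nrm (t x).
Proof.
move=> /(@sup_gt _ _) /= h; have [] := h.
  by exists (complex.Re `|t 0|), 0 => //=; rewrite normr0 ler01.
move=> _ [x /= x1 <-] rx; exists x => //.
by move: x1; rewrite normE -[1]/((1 : R)%:C%C) lecR.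
Qed.

Lemma normalize (H : hilbertSpace R) (x : H) : x <> 0 ->
  nrm ((nrm x)^-1%:C%C *: x) = 1.
Proof.
move=> x0; rewrite nrmZ ?invr_ge0 ?nrm_ge0// mulVf//.
by apply/eqP => /nrm_eq0.
Qed.

End bounded_operators.

(** * Complex modulus and series over orthogonal families *)

Definition cmod (R : realType) (z : R[i]) : R := complex.Re `|z|.

Lemma cmodE (R : realType) (z : R[i]) : `|z| = (cmod z)%:C%C.
Proof. by rewrite /cmod normc_def. Qed.

Section orthogonal_series.
Variables (R : realType) (H : hilbertSpace R).

Definition orthogonal_family (x : nat -> H) : Prop :=
  forall j k, j <> k -> hdot H (x j) (x k) = 0.

Lemma rdot_sumr (x : nat -> H) y (s : seq nat) :
  rdot y (\sum_(k <- s) x k) = \sum_(k <- s) rdot y (x k).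
Proof.
elim: s => [|k s IH]; first by rewrite !big_nil rdot0r.
by rewrite !big_cons rdotDr IH.
Qed.

Lemma hdotDl (x y z : H) : hdot H (x + y) z = hdot H x z + hdot H y z.
Proof. by rewrite linearDl. Qed.

Lemma hdotZl (c : R[i]) (x y : H) : hdot H (c *: x) y = c * hdot H x y.
Proof. by rewrite linearZl. Qed.

Lemma hdotZr (c : R[i]) (x y : H) :
  hdot H x (c *: y) = Num.conj c * hdot H x y.
Proof. by rewrite hdotC hdotZl rmorphM [in RHS]hdotC. Qed.

Lemma pythagoras (x : nat -> H) (c : nat -> R[i]) (s : seq nat) :
  orthogonal_family x -> uniq s ->
  nrm (\sum_(k <- s) c k *: x k) ^+ 2 = \sum_(k <- s) (cmod (c k) * nrm (x k)) ^+ 2.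
Proof.
move=> ox; elim: s => [_|k s IH]; first by rewrite !big_nil nrm0 expr0n.
move=> /= /andP[ks us]; rewrite !big_cons nrm_sqrD IH// rdot_sumr big1_seq; last first.
  move=> j /= js; rewrite /rdot hdotZl hdotZr ox ?mulr0// => kj.
  by rewrite kj js in ks.
rewrite mulr0 addr0; congr (_ + _).
by rewrite /nrm normrZ normE normc_def/= /cmod normc_def/= mul0r subr0.
Qed.

(** Expand the squared norm of [y] minus its expansion along the [x k]. These have norm at most 1,
    not equal to 1, so the quadratic term is only bounded by the sum of squared coefficients. *)
Lemma bessel (x : nat -> H) (y : H) (s : seq nat) :
  orthogonal_family x -> (forall k, nrm (x k) <= 1) -> uniq s ->
  \sum_(k <- s) cmod (hdot H y (x k)) ^+ 2 <= nrm y ^+ 2.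
Proof.
move=> ox x1 us.
have := sqr_ge0 (nrm (y - \sum_(k <- s) hdot H y (x k) *: x k)).
rewrite nrm_sqrB pythagoras// rdot_sumr.
have -> : \sum_(k <- s) rdot y (hdot H y (x k) *: x k)
        = \sum_(k <- s) cmod (hdot H y (x k)) ^+ 2.
  apply: eq_bigr => k _; by rewrite /rdot hdotZr mulrC -normCK cmodE -rmorphXn.
have : \sum_(k <- s) (cmod (hdot H y (x k)) * nrm (x k)) ^+ 2
       <= \sum_(k <- s) cmod (hdot H y (x k)) ^+ 2.
  apply: ler_sum => k _; rewrite exprMn ler_piMr ?sqr_ge0//.
  by rewrite expr_le1// nrm_ge0.
by move=> h1 h2; lra.
Qed.

Lemma cvg_nrm_near (f : nat -> H) l e : f @ \oo --> l -> 0 < e ->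
  exists N, forall n, (N <= n)%N -> nrm (l - f n) < e.
Proof.
move=> /cvgr_dist_lt /(_ e%:C%C); rewrite ltcR => h /h [N _ hN].
by exists N => n /hN; rewrite normE ltcR.
Qed.

Lemma cvg_nrm_le (f : nat -> H) l M : f @ \oo --> l ->
  (forall n, nrm (f n) <= M) -> nrm l <= M.
Proof.
move=> fl fM; apply/ler_addgt0Pr => e /(cvg_nrm_near fl)[n /(_ n (leqnn n)) hn].
have := nrmD (l - f n) (f n); rewrite subrK => /le_trans; apply.
by rewrite addrC lerD// ltW.
Qed.

(** By [pythagoras] a block of terms is dominated by the same block of the Bessel series of [y],
    which converges. Convergence is pointwise in [y], and the limit has norm at most 1. *)
Lemma orthogonal_series (x x' : nat -> H) :
  orthogonal_family x -> orthogonal_family x' ->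
  (forall k, nrm (x k) <= 1) -> (forall k, nrm (x' k) <= 1) ->
  exists2 t : H -> H, bounded_operator t &
    forall y, (fun n => \sum_(0 <= k < n) hdot H y (x k) *: x' k) @ \oo --> t y.
Proof.
move=> ox ox' x1 x1'.
pose S y n := \sum_(0 <= k < n) hdot H y (x k) *: x' k.
have SB y m n : (m <= n)%N ->
    nrm (S y n - S y m) ^+ 2 <= \sum_(m <= k < n) cmod (hdot H y (x k)) ^+ 2.
  move=> mn; rewrite /S (@big_cat_nat _ _ _ m 0 n)//= addrAC subrr add0r.
  rewrite pythagoras ?iota_uniq//; apply: ler_sum => k _.
  by rewrite exprMn ler_piMr ?sqr_ge0// expr_le1// nrm_ge0.
have Scvg y : cvgn (S y).
  pose v n := \sum_(0 <= k < n) cmod (hdot H y (x k)) ^+ 2.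
  have vnd : nondecreasing_seq v.
    apply/nondecreasing_seqP => n; rewrite /v big_nat_recr//=.
    by rewrite lerDl sqr_ge0.
  have vub : has_ubound (range v).
    by exists (nrm y ^+ 2) => _ [n _ <-]; apply: bessel => //; rewrite iota_uniq.
  have vc := nondecreasing_is_cvgn vnd vub.
  apply/cauchy_cvgP/cauchy_ballP => e e_gt0.
  (* The radius [e] lies in [R[i]]; being positive, it is real. *)
  have e0 : 0 < complex.Re e by move: e_gt0; rewrite ltcE => /andP[].
  have eE : e = (complex.Re e)%:C%C by rewrite RRe_real// gtr0_real.
  have /cauchy_cvgP/cauchy_ballP/(_ (complex.Re e ^+ 2)) := vc.
  rewrite exprn_gt0// => /(_ isT) [[A B] [[N1 _ N1A] [N2 _ N2B]] AB].
  pose N := maxn N1 N2.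
  have hN m n : (N <= m)%N -> (m <= n)%N -> nrm (S y n - S y m) < complex.Re e.
    move=> Nm mn; rewrite -ltr_sqr ?nnegrE ?nrm_ge0 ?ltW//.
    apply: le_lt_trans (SB _ _ _ mn) _.
    have : ball (v n) (complex.Re e ^+ 2) (v m).
      apply: (AB (v n, v m)); split=> /=; [apply: N1A|apply: N2B] => /=.
        by rewrite (leq_trans _ (leq_trans Nm mn))// leq_maxl.
      by rewrite (leq_trans _ Nm)// leq_maxr.
    rewrite /ball/= /v (@big_cat_nat _ _ _ m 0 n)//= addrAC subrr add0r ger0_norm//.
    by apply: sumr_ge0 => k _; rewrite sqr_ge0.
  exists (S y @` [set n | (N <= n)%N], S y @` [set n | (N <= n)%N]) => /=.
    by split; exists N => // n /= Nn; exists n.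
  move=> [_ _] /= [[n Nn <-] [m Nm <-]] /=.
  rewrite -ball_normE/= normE eE ltcR.
  case: (leqP m n) => mn; first exact: hN.
  by rewrite -nrmN opprB; apply: hN => //; exact: ltnW.
exists (fun y => limn (S y)) => [|y]; last exact: Scvg.
apply: (@bounded_of_nrm _ _ _ _ 1) => [a y z|y].
  have -> : S (a *: y + z) = (fun n => a *: S y n + S z n).
    apply/funext => n; rewrite /S scaler_sumr -big_split/=.
    by apply: eq_bigr => k _; rewrite hdotDl hdotZl scalerDl scalerA.
  apply/cvg_lim => //.
  by apply: cvgD; [apply: cvgZr; exact: Scvg|exact: Scvg].
rewrite mul1r.
apply: (@cvg_nrm_le (S y)); [exact: Scvg|move=> n].
rewrite -ler_sqr ?nnegrE ?nrm_ge0//.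
have := SB y _ _ (leq0n n); rewrite {2}/S big_geq// subr0 => /le_trans -> //.
by apply: bessel => //; rewrite iota_uniq.
Qed.

End orthogonal_series.

(** * Finite sets, subsequences and the gliding hump *)

Lemma finite_set_rec (T : Type) (P : set T -> Prop) :
  P set0 -> (forall A x, ~ A x -> P A -> P (x |` A)) ->
  forall A, finite_set A -> P A.
Proof.
elim/Pchoice: T => T in P *; move=> P0 PS A /finite_seqP[s ->].
elim: s => [|x s IH]; first by rewrite set_nil.
have -> : [set` x :: s] = x |` [set` s].
  apply/seteqP; split=> y /=; rewrite inE.
    by move=> /orP[/eqP|]; [left|right].
  by move=> [->|->]; rewrite ?eqxx ?orbT.
have [xs|xs] := pselect ([set` s] x); last exact: PS.
by rewrite setUidr// => _ ->.
Qed.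

(** Each index is chosen beyond the threshold of its predecessor, so the threshold of [phi j] is
    passed by [phi j.+1] and by all later indices. *)
Lemma extract_subsequence (P : nat -> nat -> Prop) :
  (forall n, exists N, forall m, (N <= m)%N -> P n m) ->
  exists2 phi : nat -> nat, {homo phi : j k / (j < k)%N} &
    forall j k, (j < k)%N -> P (phi j) (phi k).
Proof.
move=> /choice[N PN]; pose phi := fix phi k :=
  if k is k'.+1 then (maxn (N (phi k')) (phi k').+1) else 0%N.
have phiS k : (phi k < phi k.+1)%N by rewrite /= leq_max leqnn orbT.
have phi_lt : {homo phi : j k / (j < k)%N}.
  by apply: homo_ltn => //; exact: ltn_trans.
exists phi => // j k jk; apply: PN; apply: (@leq_trans (phi j.+1)).
  by rewrite /= leq_max leqnn.
by move: jk; rewrite leq_eqVlt => /orP[/eqP <-//|/phi_lt/ltnW].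
Qed.

Section gliding_hump.
Variables (R : realType) (I : Type) (mu : nat -> set I -> R).
Hypothesis muU : forall n A B, A `&` B = set0 -> mu n (A `|` B) = mu n A + mu n B.
Hypothesis mu_tight : forall n e, 0 < e -> exists2 K, finite_set K &
  forall S, S `&` K = set0 -> `|mu n S| <= e.
Hypothesis mu_null : forall S e, 0 < e ->
  exists N, forall n, (N <= n)%N -> `|mu n S| <= e.

Let mu0 n : mu n set0 = 0.
Proof. by apply: (addrI (mu n set0)); rewrite -muU ?setU0 ?setI0// addr0. Qed.

(** Smallness on singletons adds up to smallness uniform over all subsets of a finite set. *)
Let mu_finite K : finite_set K -> forall e, 0 < e ->
  exists N, forall n, (N <= n)%N -> forall S, S `<=` K -> `|mu n S| <= e.
Proof.
move: K; apply: finite_set_rec => [e e0|K x Kx IH e e0].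
  by exists 0%N => n _ S; rewrite subset0 => ->; rewrite mu0 normr0 ltW.
have e20 : 0 < e / 2 by lra.
have [N1 hN1] := IH _ e20; have [N2 hN2] := mu_null [set x] e20.
exists (maxn N1 N2) => n; rewrite geq_max => /andP[N1n N2n] S SK.
have S'K : S `&` K `<=` K by move=> ? [].
have [Sx|Sx] := pselect (S x).
  have -> : S = [set x] `|` (S `&` K).
    apply/seteqP; split=> [y Sy|y [->//|[]//]].
    by have [->|Ky] := SK _ Sy; [left|right].
  rewrite muU; last by rewrite -subset0 => y [->] [].
  rewrite (le_trans (ler_normD _ _))//.
  have := hN1 _ N1n _ S'K; have := hN2 _ N2n; lra.
rewrite (_ : S = S `&` K); first by have := hN1 _ N1n _ S'K; lra.
apply/seteqP; split=> [y Sy|y []//]; split=> //.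
by have [yx|//] := SK _ Sy; rewrite yx in Sy.
Qed.

(* Schur's theorem for l^1, as a gliding hump: if [mu n (T n)] stayed above [e],
   the union of the essential parts of a sparse subsequence of the [T n] would
   be a single set on which [mu] does not tend to zero. *)
Lemma mu_null_uniform (T : nat -> set I) e : 0 < e ->
  exists n, `|mu n (T n)| <= e.
Proof.
move=> e0; apply: contrapT => /forallNP muT.
have d0 : 0 < e / 8 by lra.
have /choice[K /all_and2[finK tightK]] : forall n, exists K, finite_set K /\
    forall S, S `&` K = set0 -> `|mu n S| <= e / 8.
  by move=> n; have [K ? ?] := mu_tight n d0; exists K.
pose L n := \bigcup_(k in `I_n.+1) K k.
have finL n : finite_set (L n) by apply: bigcup_finite.
have L_sub m n : (m <= n)%N -> L m `<=` L n.
  by move=> mn x [k /= km Kx]; exists k => //=; exact: leq_trans km _.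
have [phi phi_lt hphi] := @extract_subsequence
  (fun n m => forall S, S `<=` L n -> `|mu m S| <= e / 8)
  (fun n => mu_finite (finL n) d0).
(* Outside [L (phi k)] and inside [prev k] the function [mu (phi k)] is small. The windows between
   [prev k] and [L (phi k)] are disjoint, so [S] agrees with [T (phi k)] on the [k]-th window. *)
pose prev k := if k is k'.+1 then L (phi k') else set0.
pose S := \bigcup_k (T (phi k) `&` (L (phi k) `\` prev k)).
have prev_sub k j : (k < j)%N -> L (phi k) `<=` prev j.
  case: j => // j; rewrite ltnS leq_eqVlt => /orP[/eqP ->//|/phi_lt/ltnW].
  exact: L_sub.
have prev_small k A : A `<=` prev k -> `|mu (phi k) A| <= e / 8.
  case: k => [|k Ak]; first by rewrite subset0 => ->; rewrite mu0 normr0 ltW.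
  exact: (hphi k k.+1).
have tail_small k A : A `&` L (phi k) = set0 -> `|mu (phi k) A| <= e / 8.
  move=> AL; apply: tightK; rewrite -subset0 => x [Ax Kx].
  by rewrite -AL; split=> //; exists (phi k) => /=.
have cut k A : mu (phi k) A = mu (phi k) (A `&` prev k)
    + mu (phi k) (A `&` (L (phi k) `\` prev k)) + mu (phi k) (A `\` L (phi k)).
  have pL : prev k `<=` L (phi k).
    by case: k => // k; apply: L_sub; apply: ltnW; exact: phi_lt.
  rewrite -muU; last by rewrite -subset0 => x [[_ ?] [_ []]].
  rewrite -muU; last first.
    by rewrite -subset0 => x [[[_ /pL Lx]|[_ [Lx _]]] [_]]; exact.
  congr mu; apply/seteqP; split=> [x Ax|x [[[]|[]]|[]]//].
  have [Lx|Lx] := pselect (L (phi k) x); last by right.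
  by left; have [px|px] := pselect (prev k x); [left|right].
have [N hN] := mu_null S d0; have := hN (phi N).
have -> : (N <= phi N)%N by elim: N {hN} => // N /leq_ltn_trans; apply; exact: phi_lt.
move=> /(_ isT); rewrite (cut N S).
have -> : S `&` (L (phi N) `\` prev N) = T (phi N) `&` (L (phi N) `\` prev N).
  apply/seteqP; split=> [x [[k _ [Tx [Lx px]]] [LNx pNx]]|x [Tx Lx]].
    have [kN|Nk|kN] := ltngtP k N.
    - by exfalso; apply: pNx; exact: (prev_sub _ _ kN).
    - by exfalso; apply: px; exact: (prev_sub _ _ Nk).
    - by rewrite -kN.
  by split=> //; exists N.
have h1 : `|mu (phi N) (S `&` prev N)| <= e / 8 by apply: prev_small => ? [].
have h2 : `|mu (phi N) (S `\` L (phi N))| <= e / 8.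
  by apply: tail_small; rewrite -subset0 => ? [[]].
have h3 : `|mu (phi N) (T (phi N) `&` prev N)| <= e / 8.
  by apply: prev_small => ? [].
have h4 : `|mu (phi N) (T (phi N) `\` L (phi N))| <= e / 8.
  by apply: tail_small; rewrite -subset0 => ? [[]].
(* The value on [S] and the heads and tails of [S] and [T (phi N)] contribute [e / 8] each, five
   times in all. *)
move=> h5; apply: (muT (phi N)); rewrite (cut N (T (phi N))).
move: h1 h2 h3 h4 h5; rewrite !ler_norml.
move=> /andP[? ?] /andP[? ?] /andP[? ?] /andP[? ?] /andP[? ?].
by apply/andP; split; lra.
Qed.

End gliding_hump.

(** * Coarse spaces and cofinal sequences of entourages *)

Section coarse.
Local Open Scope relation_scope.

Definition far (X : Type) (E : set (X * X)) (B B' : set X) : Prop :=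
  forall y z, B y -> B' z -> ~ E (y, z).

Lemma far_sub (X : Type) (E E' : set (X * X)) (B B' : set X) :
  E' `<=` E -> far E B B' -> far E' B B'.
Proof. by move=> E'E EB y z By Bz /E'E; exact: EB. Qed.

Lemma not_far (X : Type) (E : set (X * X)) (B B' : set X) :
  ~ far E B B' -> exists y z, [/\ B y, B' z & E (y, z)].
Proof.
move=> nf; apply: contrapT => /forallNP h; apply: nf => y z By Bz Eyz.
by have /forallNP/(_ z) := h y; apply.
Qed.

Variable X : coarseSpace.

Lemma entourage_comp3 (A B C : set (X * X)) : coarse_entourage A ->
  coarse_entourage B -> coarse_entourage C ->
  coarse_entourage [set p | exists x y, [/\ A (p.1, x), B (x, y) & C (y, p.2)]].
Proof.
have [_ cs _ _ cc] := coarseP X => EA EB EC.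
apply: cs (cc _ _ (cc _ _ EA EB) EC) => -[p q] [x [y [/= Ax Bxy Cy]]].
by exists y => //; exists x.
Qed.

Lemma bounded_entourage (B : set X) :
  coarse_bounded B -> coarse_entourage (B `*` B).
Proof. by have [_ cs _ _ _] := coarseP X => -[E EE /cs]; exact. Qed.

(** [F n.+1] absorbs the square and transpose of [F n] and one more generator. The sets contained in
    some [F n] then form a coarse structure containing the generators, hence include all
    entourages. *)
Lemma cofinal_entourages : countably_generated X -> forall E0 : set (X * X),
  coarse_entourage E0 -> exists F : nat -> set (X * X),
    [/\ forall n, coarse_entourage (F n), forall n, E0 `<=` F n,
        forall m n, (m <= n)%N -> F m `<=` F n &
        forall E, coarse_entourage E -> exists n, E `<=` F n].
Proof.
have [cd cs cU ct cc] := coarseP X; move=> [G cG EG] E0 E0E.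
have [g gE gG] : exists2 g : nat -> set (X * X),
    forall n, coarse_entourage (g n) & G `<=` range g.
  have GE : G `<=` @coarse_entourage X by rewrite EG; exact: sub_gen_smallest.
  have [g gsurj] := elimT pcard_surjP cG.
  (* The enumeration may take values outside [G]; these are replaced by the empty set. *)
  exists (fun n => [set p | G (g n) /\ g n p]) => [n|A GA].
    have [Ggn|Ggn] := pselect (G (g n)); last by apply: cs cd => p [].
    by apply: cs (GE _ Ggn) => p [].
  have [n _ gn] := gsurj _ GA; exists n => //.
  by apply/seteqP; split=> [p []|p Ap]; rewrite gn.
pose F := fix F n := if n is m.+1
  then F m `|` (F m \; F m) `|` (F m)^-1 `|` g m else E0 `|` diagonal.
have FS n : F n `<=` F n.+1 by move=> p Fp /=; do 3 left.
have FE n : coarse_entourage (F n).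
  elim: n => [|n IH] /=; first exact: cU.
  exact: cU (cU _ _ (cU _ _ IH (cc _ _ IH IH)) (ct _ IH)) (gE n).
have F_sub m n : (m <= n)%N -> F m `<=` F n.
  elim: n => [|n IH]; first by rewrite leqn0 => /eqP ->.
  by rewrite leq_eqVlt => /orP[/eqP ->//|/IH h p /h/FS].
exists F; split=> // [n p E0p|]; first by apply: (F_sub 0%N) => //; left.
rewrite EG; apply: (@smallest_sub _ _ _ [set E | exists n, E `<=` F n]).
  split => /=.
  - by exists 0%N => p dp; right.
  - by move=> A B AB [n Bn]; exists n; exact: subset_trans Bn.
  - move=> A B [m Am] [n Bn]; exists (maxn m n) => p [/Am|/Bn];
      by apply: F_sub; rewrite ?leq_maxl ?leq_maxr.
  - by move=> A [n An]; exists n.+1 => p /An /= ?; left; right.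
  - move=> A B [m Am] [n Bn]; exists (maxn m n).+1 => p [y /Am Ay /Bn By].
    left; left; right; exists y => /=.
      by apply: F_sub Ay; rewrite leq_maxl.
    by apply: F_sub By; rewrite leq_maxr.
by move=> A /gG[n _ <-]; exists n.+1 => p gp; right.
Qed.

End coarse.

(** * Unions of discs of an LFCM space *)

Section lfcm.
Local Open Scope relation_scope.
Variable X : lfcmSpace.
Implicit Types (A B : set X) (x y : X).
Local Notation disc := (@disc X).
Local Notation Edisc := (@Edisc X).

Lemma msets0 : msets (set0 : set X).
Proof. exact: boolalg_set0 (msetsP X). Qed.

Lemma msetsC A : msets A -> msets (~` A).
Proof. exact: (boolalg_setC (msetsP X)). Qed.

Lemma msetsU A B : msets A -> msets B -> msets (A `|` B).
Proof. exact: (boolalg_setU (msetsP X)). Qed.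

Lemma msetsI A B : msets A -> msets B -> msets (A `&` B).
Proof.
move=> mA mB; rewrite -[A `&` B]setCK setCI.
by apply/msetsC/msetsU; exact: msetsC.
Qed.

Lemma disc_total x : exists i, disc i x.
Proof.
have [cov _ _] := disc_partition X.
by have : [set: X] x by []; rewrite -cov => -[i _ ?]; exists i.
Qed.

Lemma disc_inj i j x : disc i x -> disc j x -> i = j .
Proof. by have [_ tr _] := disc_partition X => ix jx; apply: tr => //; exists x. Qed.

Lemma Edisc_entourage : coarse_entourage Edisc.
Proof.
have [_ cs _ _ _] := coarseP X; have [E EE dE] := disc_bounded X.
by apply: cs EE => p [i _ ip]; exact: (dE i).
Qed.

Lemma Edisc_bounded_disc i : bounded_by Edisc (disc i).
Proof. by move=> p ip; exists i. Qed.

Lemma Edisc_sym x y : Edisc (x, y) -> Edisc (y, x).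
Proof. by move=> [i _ [ix iy]]; exists i. Qed.

Lemma Edisc_boundedP A x i :
  bounded_by Edisc A -> A x -> disc i x -> A `<=` disc i.
Proof.
move=> bA Ax ix y Ay; have [j _ [/= jx jy]] := bA (x, y) (conj Ax Ay).
by rewrite (disc_inj ix jx).
Qed.

Definition dset (S : set (disc_index X)) : set X := \bigcup_(i in S) disc i.

Lemma dset_disc S x i : disc i x -> dset S x <-> S i.
Proof.
move=> ix; split=> [[j Sj jx]|Si]; last by exists i.
by rewrite (disc_inj ix jx).
Qed.

(** The measurable sets are only a Boolean algebra, but measurability is tested disc by disc, so
    infinite unions of discs are allowed. *)
Lemma msets_dset S : msets (dset S).
Proof.
apply/(disc_local _) => i; have [Si|Si] := pselect (S i).
  rewrite (_ : _ `&` _ = disc i); first exact: disc_msets.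
  by apply/seteqP; split=> [x []//|x ix]; split=> //; exists i.
rewrite (_ : _ `&` _ = set0); first exact: msets0.
by rewrite -subset0 => x [/dset_disc Sx /Sx].
Qed.

Lemma dset1 i : dset [set i] = disc i.
Proof. exact: bigcup_set1. Qed.

Lemma dset0 : dset set0 = set0.
Proof. exact: bigcup_set0. Qed.

Lemma dsetC S : dset (~` S) = ~` dset S.
Proof.
apply/seteqP; split=> x; have [i ix] := disc_total x.
  by move=> /(dset_disc _ ix) Si /(dset_disc _ ix).
by move=> Sx; apply/(dset_disc _ ix) => Si; apply: Sx; apply/(dset_disc _ ix).
Qed.

Lemma dsetI S T : dset (S `&` T) = dset S `&` dset T.
Proof.
apply/seteqP; split=> x; have [i ix] := disc_total x.
  by move=> /(dset_disc _ ix)[Si Ti]; split; apply/(dset_disc _ ix).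
by move=> [/(dset_disc _ ix) Si /(dset_disc _ ix) Ti]; apply/(dset_disc _ ix).
Qed.

Lemma dsetU S T : dset (S `|` T) = dset S `|` dset T.
Proof. exact: bigcup_setU. Qed.

(** [dset (touching A)] is the smallest union of discs containing [A]: a measurable hull, of size
    controlled by [thick]. *)
Definition touching A : set (disc_index X) := [set i | disc i `&` A !=set0].

Lemma sub_touching A : A `<=` dset (touching A).
Proof. by move=> x Ax; have [i ix] := disc_total x; exists i => //; exists x. Qed.

Lemma touching_near A x : dset (touching A) x -> exists2 a, A a & Edisc (x, a).
Proof. by move=> [i [a [ia Aa]] ix]; exists a => //; exists i. Qed.

Definition thick (E : set (X * X)) : set (X * X) :=
  [set p | exists x y, [/\ Edisc (p.1, x), E (x, y) & Edisc (y, p.2)]].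

Lemma thick_entourage E : coarse_entourage E -> coarse_entourage (thick E).
Proof.
move=> EE; exact: (entourage_comp3 Edisc_entourage EE Edisc_entourage).
Qed.

Lemma bounded_touching E A :
  bounded_by E A -> bounded_by (thick E) (dset (touching A)).
Proof.
move=> EA [x y] [/= /touching_near[a Aa xa] /touching_near[b Ab yb]].
by exists a, b; split=> //; [exact: EA|exact: Edisc_sym].
Qed.

Lemma bounded_dset_touching A : coarse_bounded A -> coarse_bounded (dset (touching A)).
Proof.
move=> [E EE EA]; exists (thick E); [exact: thick_entourage|exact: bounded_touching].
Qed.

End lfcm.

(** * The projections of a coarse module *)

Section module.
Local Open Scope relation_scope.
Variables (R : realType) (X : lfcmSpace) (C : coarseModule R X).
Implicit Types (A B : set X) (x y : C).

Lemma chi_bounded A : msets A -> bounded_operator (chi C A).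
Proof. by move=> /(chi_projection C)[]. Qed.

Lemma chi_linear A : msets A -> linear (chi C A).
Proof. by move=> /chi_bounded[]. Qed.

Lemma chiI A B x : msets A -> msets B -> chi C A (chi C B x) = chi C (A `&` B) x.
Proof. by move=> mA mB; rewrite (chi_setI _ mA mB). Qed.

Lemma chi_idem A x : msets A -> chi C A (chi C A x) = chi C A x.
Proof. by move=> mA; rewrite chiI// setIid. Qed.

Lemma chi_hdot A x y : msets A -> hdot C (chi C A x) y = hdot C x (chi C A y).
Proof. by move=> /(chi_projection C)[_ _]; exact. Qed.

Lemma chi_rdot A x y : msets A -> rdot (chi C A x) y = rdot x (chi C A y).
Proof. by move=> mA; rewrite /rdot chi_hdot. Qed.

Lemma chi0 x : chi C set0 x = 0.
Proof.
have := chi_setU C (msets0 X) (msets0 X) (setI0 _).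
rewrite setU0 => /(congr1 (fun f => f x)) /= h.
by apply: (addrI (chi C set0 x)); rewrite -h addr0.
Qed.

Lemma chiU A B x : msets A -> msets B -> A `&` B = set0 ->
  chi C (A `|` B) x = chi C A x + chi C B x.
Proof. by move=> mA mB AB; rewrite (chi_setU _ mA mB AB). Qed.

Lemma chiC A x : msets A -> x = chi C A x + chi C (~` A) x.
Proof.
move=> mA; rewrite -chiU ?setICr//; last exact: msetsC.
by rewrite setUv chi_setT.
Qed.

Lemma chi_disjoint A B x : msets A -> msets B -> A `&` B = set0 ->
  chi C A (chi C B x) = 0.
Proof. by move=> mA mB AB; rewrite chiI// AB chi0. Qed.

Lemma chi_subset A B x : msets A -> msets B -> A `<=` B -> chi C A (chi C B x) = chi C A x.
Proof. by move=> mA mB AB; rewrite chiI// setIidl. Qed.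

Lemma chi_supset A B x : msets A -> msets B -> A `<=` B -> chi C B (chi C A x) = chi C A x.
Proof. by move=> mA mB AB; rewrite chiI// setIidr. Qed.

Lemma chi_fix_sub A B x : msets A -> msets B -> A `<=` B ->
  chi C A x = x -> chi C B x = x.
Proof. by move=> mA mB AB <-; rewrite chi_supset. Qed.

Lemma chi_orthogonal A B x y : msets A -> msets B -> A `&` B = set0 ->
  chi C A x = x -> chi C B y = y -> hdot C x y = 0.
Proof.
move=> mA mB AB <- <-; rewrite chi_hdot// chi_disjoint//.
by rewrite hdotC linear0l rmorph0.
Qed.

Lemma chi_pythagoras A x : msets A ->
  nrm x ^+ 2 = nrm (chi C A x) ^+ 2 + nrm (chi C (~` A) x) ^+ 2.
Proof.
move=> mA; have mA' := msetsC mA; rewrite {1}(chiC x mA) nrm_sqrD /rdot.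
rewrite (@chi_orthogonal A (~` A)) ?chi_idem ?setICr//=; ring.
Qed.

Lemma nrm_chi_le A x : msets A -> nrm (chi C A x) <= nrm x.
Proof.
move=> mA; rewrite -ler_sqr ?nnegrE ?nrm_ge0// (chi_pythagoras x mA).
by rewrite lerDl sqr_ge0.
Qed.

Lemma nrm_chi_mono A B x : msets A -> msets B -> A `<=` B ->
  nrm (chi C A x) <= nrm (chi C B x).
Proof. by move=> mA mB AB; rewrite -(chi_subset _ mA mB AB) nrm_chi_le. Qed.

Lemma chi_rdot_self A x : msets A -> rdot (chi C A x) x = nrm (chi C A x) ^+ 2.
Proof. by move=> mA; rewrite -{1}(chi_idem x mA) chi_rdot// rdotxx. Qed.

(** Tightness replaces countable additivity: by density [x] is close to a vector living on finitely
    many discs. *)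
Lemma chi_tight x (e : R) : 0 < e -> exists2 K : set (disc_index X), finite_set K &
  nrm (chi C (dset (~` K)) x) <= e.
Proof.
move=> e0.
have [] := @chi_dense _ _ C (ball x e%:C%C).
- by exists x; apply: ballxx; rewrite ltcR.
- exact: ball_open.
move=> y [+ ySpan]; rewrite -ball_normE/= normE ltcR => xy.
(* The vectors vanishing outside finitely many discs form a subspace containing the generators of
   the span. *)
have [K finK yK] : exists2 K : set (disc_index X), finite_set K & chi C (dset (~` K)) y = 0.
  move: y ySpan {xy}.
  apply: (@smallest_sub _ _ _ (fun y => exists2 K, finite_set K & chi C (dset (~` K)) y = 0)).
    split=> [|a u v [K finK uK] [L finL vL]].
      by exists set0 => //; rewrite linear_zero//; apply/chi_linear/msets_dset.
    exists (K `|` L); first by rewrite finite_setU.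
    have mKL := @msets_dset X (~` (K `|` L)).
    have sub1 : dset (~` (K `|` L)) `<=` @dset X (~` K).
      by move=> z [i KLi iz]; exists i => // Ki; apply: KLi; left.
    have sub2 : dset (~` (K `|` L)) `<=` @dset X (~` L).
      by move=> z [i KLi iz]; exists i => // Ki; apply: KLi; right.
    rewrite (chi_linear mKL) -(chi_subset u mKL (msets_dset _) sub1) uK.
    rewrite -(chi_subset v mKL (msets_dset _) sub2) vL.
    by rewrite !(linear_zero (chi_linear mKL)) scaler0 addr0.
  move=> _ [A [mA bA] [z _ <-]].
  have [A0|/set0P[a Aa]] := eqVneq A set0.
    exists set0 => //; rewrite A0 chi0 linear_zero//.
    by apply: chi_linear; exact: msets_dset.
  have [i ia] := disc_total a; exists [set i] => //.
  apply: chi_disjoint => //; first exact: msets_dset.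
  rewrite -subset0 => b [[j ji jb] Ab]; apply: ji.
  exact: (disc_inj jb (Edisc_boundedP bA Aa ia Ab)).
exists K => //; have mK := @msets_dset X (~` K).
rewrite -[x](subrK y) (linear_add (chi_linear mK)) yK addr0.
by rewrite (le_trans (nrm_chi_le _ mK))// ltW.
Qed.

(** Finite unions of discs are handled by linearity; the rest of [x] has small norm by
    [chi_tight]. *)
Lemma operator_local (H : hilbertSpace R) (t : C -> H) x : bounded_operator t ->
  (forall i, t (chi C (disc i) x) = 0) -> t x = 0.
Proof.
move=> bt ti; have [tl _] := bt; have [M M0 hM] := bounded_nrm bt.
have tK K : finite_set K -> t (chi C (dset K) x) = 0.
  move: K; apply: finite_set_rec => [|K i Ki IH].
    by rewrite dset0 chi0 linear_zero.
  rewrite dsetU dset1 chiU ?linear_add// ?IH ?ti ?addr0//.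
  - exact: disc_msets.
  - exact: msets_dset.
  - by rewrite -subset0 => y [iy /(dset_disc _ iy)].
apply: nrm_eq0; apply/eqP; rewrite eq_le nrm_ge0 andbT.
apply/ler_addgt0Pr => e e0; rewrite add0r.
have M1 : 0 < M + 1 by lra.
have [K finK hK] := chi_tight x (divr_gt0 e0 M1).
rewrite {1}(chiC x (msets_dset K)) linear_add// tK// add0r -dsetC.
rewrite (le_trans (hM _))// -(mulrVK (unitf_gt0 M1) e) mulrC.
by apply: ler_pM => //; [exact: nrm_ge0|lra].
Qed.

Lemma chi_local x : (forall i, chi C (disc i) x = 0) -> x = 0.
Proof.
move=> xi; apply: (@operator_local C id x) => //.
by apply: (@bounded_of_nrm _ _ _ _ 1) => // y; rewrite mul1r.
Qed.

End module.

(** * Propagation, quasi-locality and sums of rank one operators *)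

Section propagation.
Local Open Scope relation_scope.
Variables (R : realType) (X : lfcmSpace) (C : coarseModule R X).
Implicit Types (A B : set X) (x y : C) (t : C -> C).

(** The support only tests blocks inside single discs, so both sides are first cut along the
    partition. *)
Lemma op_support_far t F A B x : bounded_operator t -> op_support t `<=` F ->
  msets A -> msets B -> far F B A -> chi C B (t (chi C A x)) = 0.
Proof.
move=> bt tF mA mB FBA; apply: chi_local => i.
have mi := disc_msets i; have mBi := msetsI mi mB; rewrite chiI//.
have bT : bounded_operator (fun z => chi C (disc i `&` B) (t (chi C A z))).
  exact: bounded_comp (chi_bounded _ mBi) (bounded_comp bt (chi_bounded _ mA)).
apply: (operator_local bT) => j; have mj := disc_msets j; rewrite chiI//.
have mAj := msetsI mA mj.
have [[b [ib Bb]]|/set0P/negP/negPn/eqP ->] := pselect (disc i `&` B !=set0);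
  last exact: chi0.
have [[a [Aa ja]]|/set0P/negP/negPn/eqP ->] := pselect (A `&` disc j !=set0);
  last by rewrite chi0 (linear_zero bt.1) (linear_zero (chi_linear mBi)).
apply: contrapT => ne0; apply: (FBA b a Bb Aa); apply: tF.
exists (disc i `&` B, A `&` disc j) => //=; split=> //=.
- by move=> [p q] [[ip _] [iq _]]; exists i.
- by move=> [p q] [[_ jp] [_ jq]]; exists j.
- by move=> /(congr1 (fun f => f x)).
Qed.

(** Take the support of a controlled approximant within [e]: its coefficients between far sets
    vanish. *)
Lemma approximable_quasilocal t e : @approximable R X C t -> 0 < e ->
  exists2 F, coarse_entourage F & forall A B x y, msets A -> msets B ->
    far F B A -> nrm x <= 1 -> nrm y <= 1 -> chi C A x = x -> chi C B y = y ->
    `|rdot (t x) y| <= e.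
Proof.
move=> [bt at_] /at_ [s [bs Es] ts]; exists (op_support s) => // A B x y mA mB.
move=> FBA x1 y1 Ax By.
have -> : rdot (t x) y = rdot (t x - s x) y.
  rewrite rdotDl rdotNl; suff -> : rdot (s x) y = 0 by rewrite subr0.
  rewrite -By -chi_rdot// -Ax (op_support_far x bs _ mA mB FBA) ?rdot0l//.
apply: le_trans (rdot_abs1 _ y1) _; apply: le_trans (ltW ts).
exact: (opnorm_ge (bounded_sub bt bs) x1).
Qed.

(** A nonzero block between discs joins them by a pair of [E], so the support lies in [thick E]. *)
Lemma controlled_of_contact t E : bounded_operator t -> coarse_entourage E ->
  (forall A B x, msets A -> msets B -> chi C B (t (chi C A x)) <> 0 -> ~ far E B A) ->
  controlled_propagation t.
Proof.
move=> bt EE tE; split=> //; have [_ cs _ _ _] := coarseP X.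
apply: cs (thick_entourage EE) => -[y x] [[B A] /= [mB mA bB bA ne0]] [/= By Ax].
have [z tz] : exists z, chi C B (t (chi C A z)) <> 0.
  apply: contrapT => /forallNP h; apply: ne0; apply/funext => z /=.
  exact: contrapT (h z).
have [b [a [Bb Aa Eba]]] := not_far (tE _ _ _ mA mB tz).
by exists b, a; split=> //=; [exact: (bB (y, b))|exact: (bA (a, x))].
Qed.

Lemma controlled_approximable t : controlled_propagation t -> @approximable R X C t.
Proof.
move=> ct; have [bt _] := ct; split=> // e e0; exists t => //.
apply: le_lt_trans e0; apply: ge_sup.
  by exists (complex.Re `|(t \- t) 0|), 0 => //=; rewrite normr0.
by move=> _ [x _ <-] /=; rewrite subrr normr0.
Qed.

Lemma chi_approximable A : msets A -> @approximable R X C (chi C A).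
Proof.
move=> mA; apply: controlled_approximable.
have [cd _ _ _ _] := coarseP X.
apply: (controlled_of_contact (chi_bounded _ mA) cd) => A' B x mA' mB h Fr; apply: h.
rewrite chiI// chiI//; last exact: msetsI.
rewrite (_ : _ `&` _ = set0) ?chi0// -subset0 => y [[By _] Ay].
by apply: (Fr y y By Ay); apply/diagonalP.
Qed.

(** Nonzero blocks must meet [D] on both sides, and the square of a bounded set is an entourage. No
    control on [t] itself is required. *)
Lemma corner_approximable D t : msets D -> coarse_bounded D -> bounded_operator t ->
  @approximable R X C (chi C D \o t \o chi C D).
Proof.
move=> mD bD bt; apply: controlled_approximable.
have bDt := bounded_comp (chi_bounded C mD) (bounded_comp bt (chi_bounded C mD)).
apply: (controlled_of_contact bDt (bounded_entourage bD)) => A B x mA mB h Fr.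
apply: h => /=; rewrite chiI// (chiI _ mD)//.
have [[b [Bb Db]]|/set0P/negP/negPn/eqP ->] := pselect (B `&` D !=set0);
  last exact: chi0.
have [[a [Da Aa]]|/set0P/negP/negPn/eqP ->] := pselect (D `&` A !=set0).
  by exfalso; exact: (Fr b a Bb Aa).
by rewrite chi0 (linear_zero bt.1) (linear_zero (chi_linear (msetsI mB mD))).
Qed.

(** This is [mu_null_uniform] for the coefficients of [t] cut by [dset S], as functions of [S];
    tightness comes from [chi_tight]. *)
Lemma quasilocal_uniform t (a a' : nat -> C) : bounded_operator t ->
  (forall S e, 0 < e -> exists N, forall n, (N <= n)%N ->
    `|rdot (t (chi C (dset S) (a n))) (a' n)| <= e) ->
  forall (T : nat -> set (disc_index X)) e, 0 < e ->
    exists n, `|rdot (t (chi C (dset (T n)) (a n))) (a' n)| <= e.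
Proof.
move=> bt nul T e e0; have [M M0 hM] := bounded_nrm bt.
apply: (@mu_null_uniform R (disc_index X)
  (fun n S => rdot (t (chi C (dset S) (a n))) (a' n))) => //.
- move=> n S S' SS'; rewrite dsetU chiU; try exact: msets_dset.
    by rewrite (linear_add bt.1) rdotDl.
  by rewrite -dsetI SS' dset0.
- move=> n d d0; pose N := M * nrm (a' n) + 1.
  have N0 : 0 < N by rewrite ltr_wpDl// mulr_ge0// nrm_ge0.
  have [K finK hK] := chi_tight (a n) (divr_gt0 d0 N0); exists K => // S SK.
  apply: le_trans (rdot_abs _ _) _.
  have : nrm (chi C (dset S) (a n)) <= d / N.
    apply: le_trans hK; apply: nrm_chi_mono; try exact: msets_dset.
    by move=> x [i Si ix]; exists i => // Ki; have : (S `&` K) i by []; rewrite SK.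
  rewrite ler_pdivlMr// mulrC => h.
  have := hM (chi C (dset S) (a n)); have := nrm_ge0 (a' n).
  have := nrm_ge0 (chi C (dset S) (a n)).
  rewrite /N in h; move=> *; apply: le_trans h; rewrite mulrDl mul1r.
  apply: (@le_trans _ _ (M * nrm (chi C (dset S) (a n)) * nrm (a' n))).
    by rewrite ler_wpM2r.
  by rewrite mulrAC lerDl.
Qed.

(** The operator is the sum of the rank one maps from [x k] to [x' k]. Cutting [a n] to the discs of
    [S n] isolates the [n]-th term, whose coefficient is at least [e]; so the coefficients cannot
    tend to zero for every fixed set of discs. *)
Lemma series_gliding_hump (S : nat -> set (disc_index X)) (x x' a a' : nat -> C) e :
  (forall j k, j <> k -> S j `&` S k = set0) ->
  (forall k, chi C (dset (S k)) (x k) = x k) ->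
  orthogonal_family x' ->
  (forall k, nrm (x k) <= 1) -> (forall k, nrm (x' k) <= 1) ->
  0 < e -> (forall k, e <= rdot (hdot C (a k) (x k) *: x' k) (a' k)) ->
  exists t, [/\ bounded_operator t,
    (forall A B z, msets A -> msets B -> chi C B (t (chi C A z)) <> 0 ->
       exists2 k, chi C A (x k) <> 0 & chi C B (x' k) <> 0) &
    exists S, ~ (forall d, 0 < d -> exists N, forall n, (N <= n)%N ->
      `|rdot (t (chi C (dset S) (a n))) (a' n)| <= d)].
Proof.
move=> SS Sx ox' x1 x1' e0 hump.
have ox : orthogonal_family x.
  move=> j k jk; apply: (@chi_orthogonal _ _ _ (dset (S j)) (dset (S k))) => //;
    try exact: msets_dset.
  by rewrite -dsetI SS// dset0.
have [t bt ht] := orthogonal_series ox ox' x1 x1'; exists t; split=> //.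
  move=> A B z mA mB h; apply: contrapT => nk; apply: h.
  apply: nrm_eq0; apply/eqP; rewrite eq_le nrm_ge0 andbT.
  apply/ler_addgt0Pr => d d0; rewrite add0r.
  have [N /(_ N (leqnn N))] := cvg_nrm_near (ht (chi C A z)) d0.
  set s := \sum_(_ <= _ < _) _ => hN.
  have sB : chi C B s = 0.
    rewrite (linear_bigsum (chi_linear mB)) big1// => k _.
    rewrite (linear_scale (chi_linear mB)) chi_hdot//.
    have [Ax|Ax] := pselect (chi C A (x k) = 0).
      by rewrite Ax hdotC linear0l rmorph0 scale0r.
    have [Bx|Bx] := pselect (chi C B (x' k) = 0); first by rewrite Bx scaler0.
    by exfalso; apply: nk; exists k.
  rewrite -[t _](subrK s) (linear_add (chi_linear mB)) sB addr0.
  exact: le_trans (nrm_chi_le _ mB) (ltW hN).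
apply: contrapT => /forallNP nS.
have nul T := contrapT (nS T).
(* The varying sets are the given [S n], with bound [e / 2], which the hump exceeds. *)
have [n] := quasilocal_uniform bt nul S (divr_gt0 e0 (ltr0Sn _ 1)).
have -> : t (chi C (dset (S n)) (a n)) = hdot C (a n) (x n) *: x' n.
  apply/eqP; rewrite -subr_eq0; apply/eqP; apply: nrm_eq0.
  apply/eqP; rewrite eq_le nrm_ge0 andbT.
  apply/ler_addgt0Pr => d d0; rewrite add0r.
  have [N hN] := cvg_nrm_near (ht (chi C (dset (S n)) (a n))) d0.
  have := hN (maxn N n.+1); rewrite leq_maxl => /(_ isT)/ltW.
  rewrite (big_cat_nat (n := n.+1)) ?leq_maxr//= big_nat_recr//=.
  have term k : k <> n -> hdot C (chi C (dset (S n)) (a n)) (x k) *: x' k = 0.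
    move=> kn; rewrite (@chi_orthogonal _ _ _ (dset (S n)) (dset (S k))) ?scale0r//;
      try exact: msets_dset.
      by rewrite -dsetI SS ?dset0// => /esym.
    by rewrite chi_idem//; exact: msets_dset.
  rewrite big_nat big1 => [|k /andP[_ kn]]; last first.
    by apply: term => kn'; rewrite kn' ltnn in kn.
  rewrite big_nat big1 ?add0r ?addr0 => [|k /andP[nk _]]; last first.
    by apply: term => kn'; rewrite kn' ltnn in nk.
  by rewrite chi_hdot ?Sx//; exact: msets_dset.
rewrite ler_norml => /andP[_]; have := hump n; lra.
Qed.

End propagation.

(** * Rank one operators *)

Section rank_one.
Variables (R : realType) (H : hilbertSpace R).

Lemma nrm_scale (c : R[i]) (x : H) : nrm (c *: x) = cmod c * nrm x.
Proof. by rewrite /nrm normrZ cmodE normE /= mul0r subr0. Qed.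

(** The real inequality [rdot_le], with [y] multiplied by the scalar [hdot H x y] to make the
    product real. *)
Lemma cmod_hdot_le (x y : H) : cmod (hdot H x y) <= nrm x * nrm y.
Proof.
have [->|c0] := eqVneq (cmod (hdot H x y)) 0; first by rewrite mulr_ge0 ?nrm_ge0.
have c1 : 0 < cmod (hdot H x y).
  by rewrite lt_def c0/=; have := normr_ge0 (hdot H x y); rewrite cmodE ler0c.
have := rdot_le x (hdot H x y *: y).
rewrite /rdot hdotZr mulrC -normCK cmodE -rmorphXn/= nrm_scale expr2.
by rewrite mulrCA ler_pM2l.
Qed.

Lemma bounded_rank_one (y z : H) : bounded_operator (fun x => hdot H x y *: z).
Proof.
apply: (@bounded_of_nrm _ _ _ _ (nrm y * nrm z)) => [a u v|x].
  by rewrite hdotDl hdotZl scalerDl scalerA.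
by rewrite nrm_scale mulrAC ler_wpM2r ?nrm_ge0// mulrC cmod_hdot_le.
Qed.

End rank_one.

Lemma chi_hdot_self (R : realType) (X : lfcmSpace) (C : coarseModule R X)
    (A : set X) (x : C) : msets A ->
  hdot C (chi C A x) x = (nrm (chi C A x) ^+ 2)%:C%C.
Proof. by move=> mA; rewrite -{1}(chi_idem x mA) chi_hdot// hdotxx. Qed.

(** * Unitaries and transport of approximable operators *)

Section unitary.
Variables (R : realType) (H K : hilbertSpace R) (u : H -> K) (us : K -> H).
Hypothesis uni : unitary_operator u us.

Lemma unitary_hdot x y : hdot K (u x) y = hdot H x (us y).
Proof. by have [_ _] := uni. Qed.

Lemma unitary_rdot x y : rdot (u x) y = rdot x (us y).
Proof. by rewrite /rdot unitary_hdot. Qed.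

Lemma unitaryK x : us (u x) = x.
Proof. by have [_ _ _ /(congr1 (fun f => f x))] := uni. Qed.

Lemma unitary_nrm x : nrm (u x) = nrm x.
Proof.
apply/eqP; rewrite -(@eqrXn2 _ 2) ?nrm_ge0//.
by rewrite -!rdotxx unitary_rdot unitaryK.
Qed.

Lemma unitary_sym : unitary_operator us u.
Proof.
have [bu bus adj usu uus] := uni; split=> // y x.
by rewrite hdotC -adj [in RHS]hdotC.
Qed.

End unitary.

(** One direction of the isomorphism, so that each result can be applied to [u] and to its
    adjoint. *)
Definition transports (R : realType) (X Y : lfcmSpace) (CX : coarseModule R X)
    (CY : coarseModule R Y) (u : CX -> CY) (us : CY -> CX) : Prop :=
  forall t, @approximable R X CX t -> @approximable R Y CY (Ad u us t).

(** * Uniform estimates for transported operators *)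

Section transport.
Local Open Scope relation_scope.
Variables (R : realType) (X Y : lfcmSpace) (CX : coarseModule R X).
Variables (CY : coarseModule R Y) (u : CX -> CY) (us : CY -> CX).
Hypothesis uni : unitary_operator u us.
Hypothesis uT : transports u us.
Hypothesis cgY : countably_generated Y.
Implicit Types (B : set Y) (w : CY) (D : set X).

Let bu : bounded_operator u. Proof. by have [] := uni. Qed.
Let bus : bounded_operator us. Proof. by have [] := uni. Qed.
Let uni' : unitary_operator us u. Proof. exact: unitary_sym. Qed.

(** The coefficient of [Ad u us t] between [w] and [w'] is that of [t] between [us w] and
    [us w']. *)
Lemma transport_quasilocal t e : @approximable R X CX t -> 0 < e ->
  exists2 F, coarse_entourage F & forall B B' w w', msets B -> msets B' ->
    far F B' B -> nrm w <= 1 -> nrm w' <= 1 -> chi CY B w = w -> chi CY B' w' = w' ->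
    `|rdot (t (us w)) (us w')| <= e.
Proof.
move=> /uT at_ e0; have [F EF hF] := approximable_quasilocal at_ e0.
exists F => // B B' w w' mB mB' FB w1 w1' wB wB'.
by rewrite -(unitary_rdot uni); exact: (hF B B').
Qed.

Lemma nrm_corner_le D w : msets D -> nrm w <= 1 -> nrm (chi CX D (us w)) <= 1.
Proof.
by move=> mD; apply: le_trans; rewrite -(unitary_nrm uni' w) nrm_chi_le.
Qed.

(* The bounded piece [D] of [X] occupies only a neighbourhood of [B0] in [Y];
   otherwise some [w n] escape to infinity, they become mutually far because the
   rank one operators between the [D (us (w n))] are transported, and an
   operator shifting a sparse subsequence of the [w n] contradicts
   quasi-locality. *)
Lemma corner_concentrated D B0 w0 : msets D -> coarse_bounded D -> msets B0 ->
  nrm w0 <= 1 -> chi CY B0 w0 = w0 -> chi CX D (us w0) <> 0 ->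
  forall e, 0 < e -> exists2 F, coarse_entourage F & forall B w, msets B ->
    coarse_bounded B -> far F B B0 -> chi CY B w = w -> nrm w <= 1 ->
    nrm (chi CX D (us w)) <= e.
Proof.
move=> mD bD mB0 w01 wB0 b0 e e0.
have [F [EF EdF F_sub Fcof]] := cofinal_entourages cgY (Edisc_entourage Y).
apply: contrapT => nF.
have /choice[Bw /all_and2[/all_and3[mB bB FB0] /all_and3[wB w1 we]]] : forall n,
    exists Bw : set Y * CY,
    [/\ msets Bw.1, coarse_bounded Bw.1 & far (F n) Bw.1 B0] /\
    [/\ chi CY Bw.1 Bw.2 = Bw.2, nrm Bw.2 <= 1 & e < nrm (chi CX D (us Bw.2))].
  move=> n; apply: contrapT => /forallNP h; apply: nF; exists (F n) => // B w.
  move=> mB bB FB wB w1; rewrite leNgt; apply/negP => we.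
  by apply: (h (B, w)); split; split.
pose B n := (Bw n).1; pose w n := (Bw n).2.
have Bfar n : exists N, forall m, (N <= m)%N -> far (F n) (B m) (B n).
  pose b v := chi CX D (us v).
  have bt := corner_approximable mD bD (bounded_rank_one (b w0) (b (w n))).
  pose d := nrm (b w0) ^+ 2 * nrm (b (w n)) ^+ 2.
  have d0 : 0 < d.
    rewrite mulr_gt0// exprn_gt0// lt_def nrm_ge0 andbT; apply/eqP => /nrm_eq0//.
    by move=> bn0; have := lt_trans e0 (we n); rewrite -/(b _) bn0 nrm0 ltxx.
  (* The transported rank one corner has coefficient [d] between [w0] and [w n], above the bound
     [d / 2]; hence [B n] is within [F'] of [B0]. *)
  have [F' EF' hF'] := transport_quasilocal bt (divr_gt0 d0 (ltr0Sn _ 1)).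
  have /not_far[y [z [By B0z F'yz]]] : ~ far F' (B n) B0.
    move=> /(hF' _ _ _ _ mB0 (mB n))/(_ w01 (w1 n) wB0 (wB n)) /=.
    rewrite (linear_scale (chi_linear mD)) -/(b w0) hdotxx !chi_idem//.
    rewrite rdotZl chi_rdot_self// ler_norml => /andP[_].
    by rewrite -/(b (w n)) -/d; lra.
  (* If [B m] came within [F n] of [B n], it would be near [B0] through the bounded set [B n], which
     fails for large [m]. *)
  have [N hN] := Fcof _ (entourage_comp3 (EF n) (bounded_entourage (bB n)) EF').
  exists N => m Nm y' x' By' Bx' Fyx; apply: (FB0 m y' z By' B0z).
  by apply: (F_sub _ _ Nm); apply: hN; exists x', y.
have [phi phi_lt phi_far] := extract_subsequence Bfar.
have phi_ge k : (k <= phi k)%N.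
  by elim: k => // k IH; apply: leq_ltn_trans IH (phi_lt _ _ (ltnSn k)).
pose S k := touching (B (phi k)).
have SS j k : j <> k -> S j `&` S k = set0.
  wlog jk : j k / (j < k)%N.
    move=> h jk; case: (ltngtP j k) => // [|kj]; first by move=> /h; exact.
    by rewrite setIC; apply: h => // /esym.
  move=> _; rewrite -subset0 => i [[y [iy By]] [z [iz Bz]]].
  by apply: (phi_far _ _ jk z y Bz By); apply: EdF; exists i.
have wS k : chi CY (dset (S k)) (w (phi k)) = w (phi k).
  by apply: chi_fix_sub (wB _) => //; [exact: msets_dset|exact: sub_touching].
have ow : orthogonal_family (w \o phi).
  move=> j k jk.
  apply: (@chi_orthogonal _ _ _ (dset (S j)) (dset (S k))) => //;
    try exact: msets_dset.
  by rewrite -dsetI SS// dset0.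
(* Pairing [a k] with [w (phi k)] gives the squared norm of a corner, above [e ^+ 2]; the shift
   involves two such factors, hence [e ^+ 4]. *)
pose a k := u (chi CX D (us (w (phi k)))).
have [] := @series_gliding_hump _ _ _ S (w \o phi) (fun k => w (phi k.+1))
  a (fun k => a k.+1) (e ^+ 4) SS wS.
- by move=> j k jk; apply: ow => -[].
- by move=> k; exact: w1.
- by move=> k; exact: w1.
- by rewrite exprn_gt0.
- move=> k /=; rewrite /a (unitary_hdot uni) chi_hdot_self// rdotZl.
  rewrite -(unitary_rdot uni') rdotC chi_rdot_self// -[4%N]/(2 + 2)%N exprD.
  have wen n : e ^+ 2 <= nrm (chi CX D (us (w n))) ^+ 2.
    by rewrite ler_sqr ?nnegrE ?nrm_ge0 ?(ltW e0)//; exact/ltW/we.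
  by apply: ler_pM; rewrite ?sqr_ge0 ?wen.
move=> t [bt _ [T]]; apply=> d d0.
(* The coefficient of [t] between the cut [a k] and [a k.+1] is one of the corner at [D] of this
   operator, taken between [us (w (phi k))] and [us (w (phi k.+1))]. *)
have bs : bounded_operator (us \o t \o chi CY (dset T) \o u).
  apply: bounded_comp bu; apply: bounded_comp (chi_bounded CY (msets_dset T)).
  exact: bounded_comp bus bt.
have [F' EF' hF'] := transport_quasilocal (corner_approximable mD bD bs) d0.
have [N hN] := Fcof _ EF'; exists N => k Nk.
have Fk : far F' (B (phi k.+1)) (B (phi k)).
  apply: far_sub (phi_far _ _ (ltnSn k)); apply: subset_trans hN _.
  exact: F_sub (leq_trans Nk (phi_ge k)).
have := hF' _ _ _ _ (mB _) (mB _) Fk (w1 _) (w1 _) (wB _) (wB _).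
by rewrite /= chi_rdot// (unitary_rdot uni').
Qed.

(** Two sets near the same bounded [B0] are near each other. So one of [B], [B'] is far from [B0]
    and its corner is at most [e], the other being at most 1. If no [w0] has a nonzero corner, the
    product vanishes. *)
Lemma corner_far D : msets D -> coarse_bounded D ->
  forall e, 0 < e -> exists2 F, coarse_entourage F & forall B B' w w',
    msets B -> msets B' -> coarse_bounded B -> coarse_bounded B' -> far F B' B ->
    nrm w <= 1 -> nrm w' <= 1 -> chi CY B w = w -> chi CY B' w' = w' ->
    nrm (chi CX D (us w)) * nrm (chi CX D (us w')) <= e.
Proof.
move=> mD bD e e0.
have [[[B0 w0] /= [[mB0 bB0] [w01 wB0 b0]]]|none] := pselect (exists Bw : set Y * CY,
  [/\ msets Bw.1 & coarse_bounded Bw.1] /\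
  [/\ nrm Bw.2 <= 1, chi CY Bw.1 Bw.2 = Bw.2 & chi CX D (us Bw.2) <> 0]); last first.
  have [cd _ _ _ _] := coarseP Y; exists diagonal => // B B' w w'.
  move=> mB mB' bB bB' _ w1 w1' wB wB'.
  suff -> : chi CX D (us w) = 0 by rewrite nrm0 mul0r ltW.
  by apply: contrapT => b0; apply: none; exists (B, w).
have [F EF hF] := corner_concentrated mD bD mB0 w01 wB0 b0 e0.
have [_ _ _ ct _] := coarseP Y.
have EF3 := entourage_comp3 EF (bounded_entourage bB0) (ct _ EF).
apply: (ex_intro2 _ _ _ EF3).
move=> B B' w w' mB mB' bB bB' Fr w1 w1' wB wB'.
have [FB|/not_far[y [z [By Bz Fyz]]]] := pselect (far F B B0).
  rewrite -[leRHS]mulr1; apply: ler_pM; rewrite ?nrm_ge0//; first exact: (hF B).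
  exact: nrm_corner_le.
have [FB'|/not_far[y' [z' [By' Bz' Fyz']]]] := pselect (far F B' B0).
  rewrite -[leRHS]mul1r; apply: ler_pM; rewrite ?nrm_ge0//; last exact: (hF B').
  exact: nrm_corner_le.
by exfalso; apply: (Fr y' y By' By); exists z', z.
Qed.

(* A sequence of counterexamples lives either on infinitely many pieces of one
   bounded set, which is [corner_far], or on pairwise disjoint pieces; in the
   latter case the sum of the rank one operators between the pieces of
   [us (w n)] and [us (w' n)] has controlled propagation, and its image is not
   quasi-local. *)
Lemma uniform_corner_far E : coarse_entourage E ->
  forall e, 0 < e -> exists2 F, coarse_entourage F & forall D B B' w w',
    msets D -> bounded_by E D ->
    msets B -> msets B' -> coarse_bounded B -> coarse_bounded B' -> far F B' B ->
    nrm w <= 1 -> nrm w' <= 1 -> chi CY B w = w -> chi CY B' w' = w' ->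
    nrm (chi CX D (us w)) * nrm (chi CX D (us w')) <= e.
Proof.
move=> EE e e0.
have [F [EF _ F_sub Fcof]] := cofinal_entourages cgY (Edisc_entourage Y).
apply: contrapT => nF.
have /choice[p /all_and3[/all_and2[mD ED] /all_and5[mB mB' bB bB' FB]
    /all_and5[w1 w1' wB wB' pe]]] : forall n,
    exists p : set X * (set Y * set Y) * (CY * CY),
    [/\ msets p.1.1 /\ bounded_by E p.1.1,
        [/\ msets p.1.2.1, msets p.1.2.2, coarse_bounded p.1.2.1,
            coarse_bounded p.1.2.2 & far (F n) p.1.2.2 p.1.2.1] &
        [/\ nrm p.2.1 <= 1, nrm p.2.2 <= 1, chi CY p.1.2.1 p.2.1 = p.2.1,
            chi CY p.1.2.2 p.2.2 = p.2.2 &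
            e < nrm (chi CX p.1.1 (us p.2.1)) * nrm (chi CX p.1.1 (us p.2.2))]].
  move=> n; apply: contrapT => /forallNP h; apply: nF; exists (F n) => //.
  move=> D B B' w w' *; rewrite leNgt; apply/negP => we.
  by apply: (h (D, (B, B'), (w, w'))); split; split.
(* Passing to unions of discs turns disjointness of the pieces into disjointness of index sets. *)
pose T n := touching (p n).1.1; pose D n : set X := dset (T n).
pose w n := (p n).2.1; pose w' n := (p n).2.2.
have De n : e < nrm (chi CX (D n) (us (w n))) * nrm (chi CX (D n) (us (w' n))).
  apply: lt_le_trans (pe n) _.
  by apply: ler_pM; rewrite ?nrm_ge0//; apply: nrm_chi_mono => //;
    solve [exact: msets_dset|exact: sub_touching].
have EtD n : bounded_by (thick E) (D n) by exact: bounded_touching.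
have Et := thick_entourage EE.
have mDn n : msets (D n) by exact: msets_dset.
have [disj|] := pselect (forall n, exists N, forall m, (N <= m)%N ->
    T n `&` T m = set0); last first.
  move=> /existsNP[n /forallNP meet]; have [_ cs _ ct _] := coarseP X.
  (* Every [D m] sharing a disc with [D n] lies in this bounded neighbourhood of [D n]. *)
  pose L : set X := [set x | exists2 a, D n a & thick E (x, a)].
  have bDn : coarse_bounded (D n) by exists (thick E).
  have bL : coarse_bounded L.
    have EL := entourage_comp3 Et (bounded_entourage bDn) (ct _ Et).
    apply: (ex_intro2 _ _ _ EL).
    by move=> [x y] [/= [a Da xa] [b Db yb]]; exists a, b.
  have [F' EF' hF'] := corner_far (msets_dset (touching L))
    (bounded_dset_touching bL) e0.
  have [N hN] := Fcof _ EF'; have /existsNP[m] := meet N.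
  move=> /not_implyP[Nm /eqP/set0P[i [Tn Tm]]].
  have DL : D m `<=` dset (touching L).
    move=> x Dx; apply: sub_touching.
    have [_ _ ne] := disc_partition X; have [z iz] := ne i I.
    have Dz : D m z by exists i.
    by exists z; [exists i|exact: (EtD m (x, z))].
  have Fm : far F' (p m).1.2.2 (p m).1.2.1.
    by apply: far_sub (FB m); apply: subset_trans hN _; exact: F_sub.
  have := hF' _ _ _ _ (mB m) (mB' m) (bB m) (bB' m) Fm (w1 m) (w1' m) (wB m) (wB' m).
  apply/negP; rewrite -ltNge; apply: lt_le_trans (De m) _.
  by apply: ler_pM; rewrite ?nrm_ge0//; apply: nrm_chi_mono => //; exact: msets_dset.
have [phi phi_lt phi_disj] := extract_subsequence disj.
have phi_ge k : (k <= phi k)%N.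
  by elim: k => // k IH; apply: leq_ltn_trans IH (phi_lt _ _ (ltnSn k)).
have SS j k : j <> k -> T (phi j) `&` T (phi k) = set0.
  by move=> /eqP; case: ltngtP => // [/phi_disj|/phi_disj]; rewrite 1?setIC.
pose x v k := chi CX (D (phi k)) (us (v (phi k))).
have xD v k : chi CX (D (phi k)) (x v k) = x v k by rewrite /x chi_idem.
have [] := @series_gliding_hump _ _ _ (T \o phi) (x w) (x w')
  (fun k => us (w (phi k))) (fun k => us (w' (phi k))) (e ^+ 2) SS (xD w).
- move=> j k jk; apply: (@chi_orthogonal _ _ _ (D (phi j)) (D (phi k))) => //.
  by rewrite -dsetI SS// dset0.
- by move=> k; exact: (nrm_corner_le (mDn _) (w1 _)).
- by move=> k; exact: (nrm_corner_le (mDn _) (w1' _)).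
- by rewrite exprn_gt0.
- move=> k; rewrite -chi_hdot// chi_hdot_self// rdotZl chi_rdot_self// -exprMn.
  by rewrite ler_sqr ?nnegrE ?mulr_ge0 ?nrm_ge0 ?ltW.
move=> t [bt contact [S]]; apply=> d d0.
have mS := msets_dset S.
(* Each term of the series acts within a single [D (phi k)], and these are all bounded by
   [thick E]. *)
have at_ : @approximable R X CX (t \o chi CX (dset S)).
  apply: controlled_approximable.
  apply: (controlled_of_contact (bounded_comp bt (chi_bounded CX mS)) Et).
  move=> A B z mA mB0 /=; rewrite chiI// setIC -chiI// => /(contact _ _ _ mA mB0).
  move=> [k Ax Bx] Fr.
  have [[b [Bb Db]]|/set0P/negP/negPn/eqP BD0] := pselect (B `&` D (phi k) !=set0);
    last by apply: Bx; rewrite -xD chi_disjoint.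
  have [[c [Ac Dc]]|/set0P/negP/negPn/eqP AD0] := pselect (A `&` D (phi k) !=set0);
    last by apply: Ax; rewrite -xD chi_disjoint.
  by apply: (Fr b c Bb Ac); exact: (EtD (phi k) (b, c)).
have [F' EF' hF'] := transport_quasilocal at_ d0.
have [N hN] := Fcof _ EF'; exists N => k Nk.
have Fk : far F' (p (phi k)).1.2.2 (p (phi k)).1.2.1.
  apply: far_sub (FB _); apply: subset_trans hN _.
  exact: F_sub (leq_trans Nk (phi_ge k)).
exact: hF' (mB _) (mB' _) Fk (w1 _) (w1' _) (wB _) (wB' _).
Qed.

End transport.

(** For fixed [S] this is quasi-locality of a transported projection. Uniformity in [S] follows from
    [quasilocal_uniform] for the identity, along a sequence of counterexamples. *)
Lemma uniform_transport_chi (R : realType) (X Y : lfcmSpace)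
    (CX : coarseModule R X) (CY : coarseModule R Y) (u : CX -> CY) (us : CY -> CX) :
  unitary_operator u us -> transports us u -> countably_generated X ->
  forall e, 0 < e -> exists2 E, coarse_entourage E & forall A A' v v' S,
    msets A -> msets A' -> far E A' A -> nrm v <= 1 -> nrm v' <= 1 ->
    chi CX A v = v -> chi CX A' v' = v' ->
    `|rdot (us (chi CY (dset S) (u v))) v'| <= e.
Proof.
move=> uni usT cgX e e0; have uni' := unitary_sym uni.
have [F [EF _ F_sub Fcof]] := cofinal_entourages cgX (Edisc_entourage X).
apply: contrapT => nF.
have /choice[p /all_and2[/all_and3[mA mA' FA] /all_and5[v1 v1' vA vA' pe]]] :
    forall n, exists p : (set X * set X) * (CX * CX * set (disc_index Y)),
    [/\ msets p.1.1, msets p.1.2 & far (F n) p.1.2 p.1.1] /\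
    [/\ nrm p.2.1.1 <= 1, nrm p.2.1.2 <= 1, chi CX p.1.1 p.2.1.1 = p.2.1.1,
        chi CX p.1.2 p.2.1.2 = p.2.1.2 &
        e < `|rdot (us (chi CY (dset p.2.2) (u p.2.1.1))) p.2.1.2|].
  move=> n; apply: contrapT => /forallNP h; apply: nF; exists (F n) => //.
  move=> A A' v v' S *; rewrite leNgt; apply/negP => ve.
  by apply: (h ((A, A'), (v, v', S))); split; split.
have bid : bounded_operator (@id CY).
  by apply: (@bounded_of_nrm _ _ _ _ 1) => // y; rewrite mul1r.
have [] := @quasilocal_uniform _ _ CY id (fun n => u (p n).2.1.1)
    (fun n => u (p n).2.1.2) bid _ (fun n => (p n).2.2) e e0; last first.
  by move=> n; rewrite -(unitary_rdot uni') leNgt pe.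
move=> S d d0.
have [F' EF' hF'] := transport_quasilocal uni' usT
  (chi_approximable CY (msets_dset S)) d0.
have [N hN] := Fcof _ EF'; exists N => n Nn.
have Fn : far F' (p n).1.2 (p n).1.1.
  by apply: far_sub (FA n); apply: subset_trans hN _; exact: F_sub.
exact: hF' (mA n) (mA' n) Fn (v1 n) (v1' n) (vA n) (vA' n).
Qed.

(** Discs are added one at a time, those in [S] with sign plus. By the parallelogram law one of the
    two signs increases the squared norm by at least that of the new term. *)
Lemma sign_choice (R : realType) (X : lfcmSpace) (C : coarseModule R X)
    (H : hilbertSpace R) (t : C -> H) (x : C) (K : set (disc_index X)) :
  bounded_operator t -> finite_set K ->
  (forall i, K i ->
     nrm (chi C (disc i) x) ^+ 2 / 2 <= nrm (t (chi C (disc i) x)) ^+ 2) ->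
  exists2 S, S `<=` K & nrm (chi C (dset K) x) ^+ 2 / 2 <=
    nrm (t (chi C (dset S) x) - t (chi C (dset (K `\` S)) x)) ^+ 2.
Proof.
move=> bt; have [tl _] := bt; move: K; apply: finite_set_rec => [_|K i Ki IH hK].
  exists set0 => //; rewrite set0D dset0 chi0 nrm0 expr0n/= mul0r.
  exact: sqr_ge0.
have [j Kj|S SK hS] := IH; first by apply: hK; right.
have chi_insert T : ~ T i ->
    chi C (dset (i |` T)) x = chi C (disc i) x + chi C (dset T) x.
  move=> Ti; rewrite dsetU dset1 chiU//; [exact: disc_msets|exact: msets_dset|].
  by rewrite -subset0 => y [iy /(dset_disc _ iy)].
have Si : ~ S i by move=> /SK.
have KSi : ~ (K `\` S) i by case.
have chiK : nrm (chi C (dset (i |` K)) x) ^+ 2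
    = nrm (chi C (disc i) x) ^+ 2 + nrm (chi C (dset K) x) ^+ 2.
  rewrite chi_insert// nrm_sqrD /rdot.
  rewrite (@chi_orthogonal _ _ _ (disc i) (dset K)) ?chi_idem//=;
    try solve [exact: disc_msets|exact: msets_dset].
    ring.
  by rewrite -subset0 => y [iy /(dset_disc _ iy)].
set a := t _ - t _ in hS; set z := t (chi C (disc i) x).
have hz : nrm (chi C (disc i) x) ^+ 2 / 2 <= nrm z ^+ 2 by apply: hK; left.
have par := nrm_parallelogram a z.
have [az|az] := leP (nrm (a - z) ^+ 2) (nrm (a + z) ^+ 2).
  exists (i |` S); first by move=> j [->|/SK]; [left|right].
  have -> : (i |` K) `\` (i |` S) = K `\` S.
    apply/seteqP; split=> [j [[->|Kj] Sj]|j [Kj Sj]].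
    - by exfalso; apply: Sj; left.
    - by split=> // /(@or_intror (j = i)).
    - by split; [right|move=> [ji|//]; rewrite ji in Kj].
  rewrite (chi_insert S)// (linear_add tl) -addrA -/z [z + _]addrC -/a chiK; lra.
exists S; first by move=> j /SK; right.
have -> : (i |` K) `\` S = i |` (K `\` S).
  apply/seteqP; split=> [j [[->|Kj] Sj]|j [->|[Kj Sj]]].
  - by left.
  - by right.
  - by split; [left|].
  - by split; [right|].
rewrite (chi_insert (K `\` S))// (linear_add tl) opprD addrCA addrC -/z -/a chiK; lra.
Qed.

(** * Concentration and properties of the approximate relations *)

Section rigidity.
Local Open Scope relation_scope.
Variables (R : realType) (X Y : lfcmSpace) (CX : coarseModule R X).
Variables (CY : coarseModule R Y) (u : CX -> CY) (us : CY -> CX).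
Hypothesis uni : unitary_operator u us.
Hypothesis uT : transports u us.
Hypothesis cgY : countably_generated Y.

Let bu : bounded_operator u. Proof. by have [] := uni. Qed.
Let bus : bounded_operator us. Proof. by have [] := uni. Qed.
Let uni' : unitary_operator us u. Proof. exact: unitary_sym. Qed.

(* [A] being bounded, [us \o 1_S \o u] moves [v] only to a neighbourhood [A'] of
   [A], uniformly in [S]. Choosing the signs of the pieces of [u v] well, most of
   the mass of [u v] lies on discs whose pieces are sent by [us] mostly into
   [A'], and such discs are uniformly close to each other. *)
Lemma concentration (delta : R) : transports us u -> countably_generated X ->
  0 < delta < 1 -> exists2 F, coarse_entourage F &
  forall (A : set X) (v : CX), msets A -> bounded_by (@Edisc X) A ->
    chi CX A v = v -> nrm v = 1 ->
  exists J : set (disc_index Y), [/\ bounded_by F (dset J), dset J `<=` dom1 CY &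
    delta < nrm (chi CY (dset J) (u v))].
Proof.
(* [g] is the squared mass of [u v] that may be lost. *)
move=> usT cgX /andP[d0 d1]; pose g := 1 - delta ^+ 2.
have g0 : 0 < g by rewrite subr_gt0 expr_lt1// ltW.
have g1 : g <= 1 by rewrite gerBl sqr_ge0.
have g8 : 0 < g / 8 by lra.
have [E EE hE] := uniform_transport_chi uni usT cgX (exprn_gt0 2 g8).
have [_ _ _ ct _] := coarseP X.
have EN := thick_entourage (entourage_comp3 EE (Edisc_entourage X) (ct _ EE)).
(* The bound is [1 / 4]: two good discs have unit vectors with corners above [1 / 2] in [A']. *)
have [F EF hF] := uniform_corner_far uni uT cgY EN (divr_gt0 ltr01 (ltr0Sn R 3)).
exists (thick F); first exact: thick_entourage.
move=> A v mA bA Av v1; pose w := u v.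
have w1 : nrm w = 1 by rewrite (unitary_nrm uni).
pose A' : set X := dset (touching (thickening E A)).
have mA' : msets A' by exact: msets_dset.
have mA'c := msetsC mA'.
have bA' := @bounded_touching X _ (thickening E A) (fun p => fun h =>
  match h with conj (ex_intro2 x Ax px) (ex_intro2 y Ay py) =>
    ex_intro _ x (ex_intro _ y (And3 px (bA (x, y) (conj Ax Ay)) py)) end).
have farA' : far E (~` A') A.
  by move=> x a A'x Aa Exa; apply: A'x; apply: sub_touching; exists a.
pose t y := chi CX (~` A') (us y).
have bt : bounded_operator t by exact: bounded_comp (chi_bounded CX mA'c) bus.
(* Testing against the leaked component itself turns the bound [(g / 8) ^+ 2] into one on its
   squared norm. *)
have tS S : nrm (t (chi CY (dset S) w)) <= g / 8.
  set z := t _; have z1 : nrm z <= 1.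
    rewrite (le_trans (nrm_chi_le _ mA'c))// (unitary_nrm uni').
    by rewrite (le_trans (nrm_chi_le _ (msets_dset S)))// w1.
  have := hE A (~` A') v z S mA mA'c farA'.
  rewrite v1 lexx z1 chi_idem// => /(_ isT isT Av erefl).
  rewrite rdotC chi_rdot_self// -/z ger0_norm ?sqr_ge0//.
  by rewrite ler_sqr ?nnegrE ?nrm_ge0// ltW.
have [K finK hK] := chi_tight w g8.
pose wd i := chi CY (disc i) w.
(* The discs whose piece of [w] leaks less than half of its squared mass out of [A']. *)
pose J := [set i | [/\ K i, wd i <> 0 & nrm (t (wd i)) ^+ 2 < nrm (wd i) ^+ 2 / 2]].
exists J; split.
- have half i : J i -> exists2 y, chi CY (disc i) y = y & nrm y = 1 /\
      1 / 2 < nrm (chi CX A' (us y)) ^+ 2.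
    move=> [_ wi0 hi]; exists ((nrm (wd i))^-1%:C%C *: wd i).
      have mi := disc_msets i; rewrite (linear_scale (chi_linear mi)).
      by rewrite /wd chi_idem.
    split; first exact: normalize.
    have n0 : 0 < nrm (wd i).
      by rewrite lt_def nrm_ge0 andbT; apply/eqP => /nrm_eq0.
    rewrite (linear_scale bus.1) (linear_scale (chi_linear mA')).
    rewrite nrmZ ?invr_ge0 ?nrm_ge0// exprMn exprVn [ltRHS]mulrC.
    rewrite ltr_pdivlMr ?exprn_gt0//.
    have := chi_pythagoras (us (wd i)) mA'; rewrite (unitary_nrm uni') -/(t _).
    by move: hi; lra.
  move=> [p q] [[i Ji ip] [j Jj jq]].
  have [y yi [y1 hy]] := half _ Ji; have [z zj [z1 hz]] := half _ Jj.
  have bd k : coarse_bounded (@disc Y k).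
    by exists (@Edisc Y); [exact: Edisc_entourage|exact: Edisc_bounded_disc].
  have /not_far[y' [z' [iy' jz' Fyz]]] : ~ far F (disc i) (@disc Y j).
    move=> Fij.
    have := hF A' _ _ z y mA' bA' (disc_msets j) (disc_msets i) (bd j) (bd i) Fij.
    rewrite y1 z1 lexx => /(_ isT isT zj yi).
    have half_lt p' : 0 <= p' -> 1 / 2 < p' ^+ 2 -> 1 / 2 < p' :> R by nra.
    have := half_lt _ (nrm_ge0 _) hy; have := half_lt _ (nrm_ge0 _) hz; nra.
  by exists y', z'; split=> //; [exists i|exists j].
- move=> p [i [_ wi0 _] ip]; exists (disc i) => //; split.
  + exact: disc_msets.
  + exact: Edisc_bounded_disc.
  + by move=> /(congr1 (fun f => f w)).
have JK : J `<=` K by move=> i [].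
have [|S SK hS] := @sign_choice _ _ _ _ t w (K `\` J) bt (finite_setD _ finK).
  move=> i [Ki Ji]; rewrite leNgt; apply/negP => hi; apply: Ji; split=> //.
  move=> wi0; move: hi; rewrite -/(wd i) wi0 (linear_zero bt.1) !nrm0; lra.
(* On the leaking discs a signed sum leaks at least half of their squared mass, yet at most [g / 4]
   in norm. *)
have bad : nrm (chi CY (dset (K `\` J)) w) ^+ 2 <= g ^+ 2 / 8.
  have h1 : nrm (t (chi CY (dset S) w) - t (chi CY (dset (K `\` J `\` S)) w))
      <= g / 4.
    have := nrmB (t (chi CY (dset S) w)) (t (chi CY (dset (K `\` J `\` S)) w)).
    have := tS S; have := tS (K `\` J `\` S); lra.
  have := nrm_ge0 (t (chi CY (dset S) w) - t (chi CY (dset (K `\` J `\` S)) w)).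
  by move: hS h1; nra.
have mass : 1 <= nrm (chi CY (dset J) w) ^+ 2
    + nrm (chi CY (dset (K `\` J)) w) ^+ 2 + nrm (chi CY (dset (~` K)) w) ^+ 2.
  have mK := msets_dset K; have mJ := msets_dset J.
  rewrite -(expr1n R 2) -w1 (chi_pythagoras w mK) -dsetC lerD2r.
  rewrite (chi_pythagoras (chi CY (dset K) w) mJ).
  rewrite chi_subset//; last by move=> p [i /JK Ki ip]; exists i.
  by rewrite -dsetC chiI -?dsetI 1?setIC//; exact: msets_dset.
(* The losses are at most [g ^+ 2 / 8] on leaking discs and [(g / 8) ^+ 2] outside [K], together
   less than [g]. *)
have := nrm_ge0 (chi CY (dset (~` K)) w); move: hK bad mass => hK bad mass n0.
rewrite -ltr_sqr ?nnegrE ?nrm_ge0 ?(ltW d0)//.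
by rewrite (_ : delta ^+ 2 = 1 - g); [nra|rewrite /g; ring].
Qed.

(** Moving both projections and [u] across the inner product writes the square as a pairing of the
    right-hand vector with [v]. *)
Lemma nrm_corner_dual (A : set X) (B : set Y) v : msets A -> msets B ->
  nrm v <= 1 -> nrm (chi CY B (u (chi CX A v))) ^+ 2
    <= nrm (chi CX A (us (chi CY B (u (chi CX A v))))).
Proof.
move=> mA mB v1; rewrite -chi_rdot_self// -(unitary_rdot uni') -chi_rdot//.
exact: le_trans (ler_norm _) (rdot_abs1 _ v1).
Qed.

Let corner_bounded (A : set X) (B : set Y) : msets A -> msets B ->
  bounded_operator (chi CY B \o u \o chi CX A).
Proof.
move=> mA mB.
exact: bounded_comp (bounded_comp (chi_bounded CY mB) bu) (chi_bounded CX mA).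
Qed.

(** Blocks related to nearby points of [X] give vectors [w], [w'] whose corners on the common
    bounded set [D] have norm at least [delta ^+ 2]. Their product exceeds [delta ^+ 4 / 2], so [B]
    and [B'] are not far apart. *)
Lemma approx_relation_controlled (delta : R) F E : 0 < delta ->
  coarse_entourage F -> coarse_entourage E ->
  controlled (approx_relation u delta F E).
Proof.
move=> d0 EF EE E1 EE1; have [_ csY _ _ _] := coarseP Y.
have [_ _ cU ct _] := coarseP X.
pose E' : set (X * X) := [set p | exists x y,
  [/\ E (p.1, x), ((fun p => (val p.1, val p.2)) @` E1 : set (X * X)) (x, y)
    & E (y, p.2)]].
have EU : coarse_entourage E' := entourage_comp3 EE EE1 EE.
have ED := cU _ _ (cU _ _ EE EU) (ct _ EU).
have e0 : 0 < delta ^+ 4 / 2 by rewrite divr_gt0 ?exprn_gt0.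
have [F' EF' hF'] := uniform_corner_far uni uT cgY ED e0.
apply: csY (entourage_comp3 EF EF' EF) => _ [[y y'] /= rel <-] /=.
have [x' [x [rx E1xx rx']]] : exists x' x, [/\ approx_relation u delta F E (y, x),
    E1 (x, x') & approx_relation u delta F E (y', x')].
  by move: rel; move=> [p [q ? ?] ?] || move=> [p ? [q ? ?]]; exists p, q || exists q, p.
move: rx rx' => [[B A] /= [[mB mA] _ bB bA lt_d] [/= By Ax]].
move=> [[B' A'] /= [[mB' mA'] _ bB' bA' lt_d'] [/= By' Ax']].
have [v v1 /= hv] := opnorm_gt lt_d; have [v' v1' /= hv'] := opnorm_gt lt_d'.
set w := chi CY B _ in hv; set w' := chi CY B' _ in hv'.
pose D := A `|` A'; have mD := msetsU mA mA'.
have EA : ((fun p => (val p.1, val p.2)) @` E1 : set (X * X)) (val x, val x') by exists (x, x').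
have bD : bounded_by (E `|` E' `|` E'^-1) D.
  move=> [p q] [/= [Ap|Ap] [Aq|Aq]].
  - by left; left; exact: (bA (p, q)).
  - by left; right; exists (val x), (val x'); split=> //; [exact: (bA (p, _))|exact: (bA' (_, q))].
  - by right; exists (val x), (val x'); split=> //; [exact: (bA (q, _))|exact: (bA' (_, p))].
  - by left; left; exact: (bA' (p, q)).
have nw (B1 : set Y) (A1 : set X) z : msets B1 -> msets A1 -> nrm z <= 1 ->
    nrm (chi CY B1 (u (chi CX A1 z))) <= 1.
  move=> mB1 mA1 z1; rewrite (le_trans (nrm_chi_le _ mB1))// (unitary_nrm uni).
  by rewrite (le_trans (nrm_chi_le _ mA1)).
have /not_far[b [b' [Bb Bb' Fbb]]] : ~ far F' B B'.
  move=> Fr; have := hF' D B' B w' w mD bD mB' mB.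
  move=> /(_ (ex_intro2 _ _ F EF bB') (ex_intro2 _ _ F EF bB) Fr).
  rewrite !nw// /w /w' !chi_idem// -/w -/w' => /(_ isT isT erefl erefl).
  have big : delta ^+ 2 <= nrm (chi CX D (us w)).
    apply: le_trans (nrm_chi_mono _ mA mD _); last by left.
    apply: le_trans (nrm_corner_dual mA mB v1).
    by rewrite ler_sqr ?nnegrE ?nrm_ge0 ?ltW.
  have big' : delta ^+ 2 <= nrm (chi CX D (us w')).
    apply: le_trans (nrm_chi_mono _ mA' mD _); last by right.
    apply: le_trans (nrm_corner_dual mA' mB' v1').
    by rewrite ler_sqr ?nnegrE ?nrm_ge0 ?ltW.
  have := ler_pM (sqr_ge0 _) (sqr_ge0 _) big' big; rewrite -exprD.
  have := exprn_gt0 4 d0; lra.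
by exists b, b'; split=> //=; [exact: (bB (_, b))|exact: (bB' (b', _))].
Qed.

(** A unit vector on a disc-bounded set around [x] is sent mostly onto some [dset J], nonempty as
    the norm there is positive; any of its points is related to [x]. *)
Lemma approx_relation_total (delta : R) : transports us u -> countably_generated X ->
  0 < delta < 1 -> exists2 F0, coarse_entourage F0 & forall F E,
    F0 `<=` F -> @Edisc X `<=` E ->
    forall x, exists y, approx_relation u delta F E (y, x).
Proof.
move=> usT cgX d01; have [F0 EF0 hF0] := concentration usT cgX d01.
exists F0 => // F E F0F EdE [x domx]; have [A [mA bA nA] Ax] := set_mem domx.
have [z Az0] : exists z, chi CX A z <> 0.
  by apply: contrapT => /forallNP h; apply: nA; apply/funext => z; exact: contrapT (h z).
pose v := (nrm (chi CX A z))^-1%:C%C *: chi CX A z.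
have v1 : nrm v = 1 by exact: normalize.
have Av : chi CX A v = v by rewrite /v (linear_scale (chi_linear mA)) chi_idem.
have [J [bJ domJ lt_d]] := hF0 A v mA bA Av v1.
have [y Jy] : exists y, dset J y.
  apply: contrapT => /forallNP J0; move: lt_d.
  rewrite (_ : dset J = set0); last by rewrite -subset0 => y /J0.
  by rewrite chi0 nrm0; move: d01; lra.
exists (exist _ y (mem_set (domJ y Jy))); exists (dset J, A) => //=.
have mJ := msets_dset J; split.
- by [].
- by split=> // a Aa; exists A.
- exact: subset_trans F0F.
- exact: subset_trans EdE.
apply: lt_le_trans lt_d _; rewrite -{1}Av.
by apply: (opnorm_ge (corner_bounded mA mJ)); rewrite v1.
Qed.

(** Test the dual corner on the normalised image [w]: by [nrm_corner_dual] its norm there is at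
    least that of [w]. *)
Lemma opnorm_corner_dual (A : set X) (B : set Y) (delta : R) : msets A -> msets B ->
  0 < delta -> delta < opnorm (chi CY B \o u \o chi CX A) ->
  delta < opnorm (chi CX A \o us \o chi CY B).
Proof.
move=> mA mB d0 /opnorm_gt[v v1 /= hv]; set w := chi CY B _ in hv.
have n0 : 0 < nrm w by exact: lt_trans hv.
apply: lt_le_trans hv _.
have bd : bounded_operator (chi CX A \o us \o chi CY B).
  exact: bounded_comp (bounded_comp (chi_bounded CX mA) bus) (chi_bounded CY mB).
have w0 : w <> 0 by move=> w0; move: n0; rewrite w0 nrm0 ltxx.
have : nrm ((nrm w)^-1%:C%C *: w) <= 1 by rewrite normalize.
move=> /(opnorm_ge bd); apply: le_trans.
rewrite (linear_scale bd.1) nrmZ ?invr_ge0 ?nrm_ge0//= mulrC ler_pdivlMr//.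
by rewrite /w chi_idem// -expr2; exact: nrm_corner_dual.
Qed.

End rigidity.

(** * Coarse equivalences from total controlled relations, and the conclusion *)

Section relation_inverse.
Local Open Scope relation_scope.
Variables (X Y : coarseSpace) (r : set (Y * X)).
Hypothesis rc : controlled r.
Hypothesis rc' : @controlled Y X r^-1.
Hypothesis rX : forall x, exists y, r (y, x).
Hypothesis rY : forall y, exists x, r (y, x).

Lemma total_coarse_equivalence : coarse_equivalence r.
Proof.
have total (Z : coarseSpace) (A : set Z) : (forall z, A z) -> asymptotic A setT.
  have [cd _ _ _ _] := coarseP Z.
  by move=> AT; split; exists diagonal => // z _; exists z => //; apply/diagonalP.
split=> //; apply: total.
  by move=> x; have [y rxy] := rX x; exists (y, x).
by move=> y; have [x rxy] := rY y; exists (y, x).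
Qed.

(** Choose [f] and [g] inside the relation. Control of the diagonal makes points related to a common
    point uniformly close, which gives every closeness required. *)
Lemma total_coarse_inverse : coarse_inverse r r^-1.
Proof.
have [f rf] := choice rX; have [g rg] := choice rY.
have [cdX csX _ _ _] := coarseP X; have [cdY csY _ _ _] := coarseP Y.
have EY : coarse_entourage [set p : Y * Y | exists x, r (p.1, x) /\ r (p.2, x)].
  apply: csY (rc cdX) => -[y y'] [x [/= rx rx']] /=.
  by exists x => //; exists x => //; apply/diagonalP.
have EX : coarse_entourage [set p : X * X | exists y, r (y, p.1) /\ r (y, p.2)].
  apply: csX (rc' cdY) => -[x x'] [y [/= ry ry']] /=.
  by exists y => //; exists y => //; apply/diagonalP.
have close (Z W : coarseSpace) (E : set (Z * Z)) (s s' : set (Z * W)) :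
    coarse_entourage E -> (forall z w, s (z, w) -> exists2 z', s' (z', w) & E (z, z')) ->
    @coarsely_contained (prod_coarse Z W) s s'.
  have [cdW csW _ _ _] := coarseP W; have [_ csZ _ _ _] := coarseP Z.
  move=> EE ss'; exists [set p | E (p.1.1, p.2.1) /\ p.1.2 = p.2.2].
    split; first by apply: csZ EE => _ [[p q] [? _] <-].
    by apply: csW cdW => _ [[p q] [_ /= ->] <-]; apply/diagonalP.
  by move=> [z w] /ss'[z' sz Ez]; exists (z', w).
exists f, g; split; first split.
- move=> E EE; apply: csY (rc EE) => -[y y'] /= [x [z fz Ezx] fx].
  have {}fz : y = f z := fz; have {}fx : y' = f x := fx.
  by rewrite fz fx; exists x => //; exists z.
- move=> E EE; apply: csX (rc' EE) => -[x x'] /= [y [z gz Ezy] gy].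
  have {}gz : x = g z := gz; have {}gy : x' = g y := gy.
  by rewrite gz gy; exists y => //; exists z.
- split; apply: (close _ _ _ _ _ EY) => y x /= h; exists (f x) => //; exists x.
    by split.
  by have -> : y = f x := h; split; exact: rf.
- split; apply: (close _ _ _ _ _ EX) => x y /= h; exists (g y) => //; exists y.
    by split.
  by have -> : x = g y := h; split; exact: rg.
split; split.
- apply: (close _ _ _ _ _ EX) => x' x h; exists x => //.
  by have -> : x' = g (f x) := h; exists (f x); split; [exact: rg|exact: rf].
- apply: (close _ _ _ _ _ EX) => x' x h; exists (g (f x)) => //.
  by have -> : x' = x := h; exists (f x); split; [exact: rf|exact: rg].
- apply: (close _ _ _ _ _ EY) => y' y h; exists y => //.
  by have -> : y' = f (g y) := h; exists (g y); split; [exact: rf|exact: rg].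
- apply: (close _ _ _ _ _ EY) => y' y h; exists (f (g y)) => //.
  by have -> : y' = y := h; exists (g y); split; [exact: rg|exact: rf].
Qed.

End relation_inverse.

(** The threshold [delta] passes to the adjoint corner unchanged, so the relations are exact
    transposes. *)
Lemma approx_relation_adjoint (R : realType) (X Y : lfcmSpace)
    (CX : coarseModule R X) (CY : coarseModule R Y) (u : CX -> CY) (us : CY -> CX)
    (delta : R) (F : set (Y * Y)) (E : set (X * X)) :
  unitary_operator u us -> 0 < delta ->
  approx_relation us delta E F = ((approx_relation u delta F E)^-1)%relation.
Proof.
move=> uni d0; apply/seteqP; split=> -[x y] [[A B] /= [[mA mB] [sA sB] bA bB lt_d] [Ax By]];
  exists (B, A) => //; split=> //=.
- exact: (opnorm_corner_dual (unitary_sym uni)).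
- exact: (opnorm_corner_dual uni).
Qed.

Theorem corollary2p12 (R : realType) (X Y : lfcmSpace)
    (CX : coarseModule R X) (CY : coarseModule R Y)
    (U : CX -> CY) (Ustar : CY -> CX) :
  countably_generated X -> countably_generated Y ->
  unitary_operator U Ustar ->
  restricts_to_star_iso (@approximable R X CX) (@approximable R Y CY)
    (Ad U Ustar) ->
  forall delta : R, 0 < delta < 1 ->
  exists F0 : set (Y * Y), exists E0 : set (X * X),
    [/\ coarse_entourage F0, coarse_entourage E0 &
        forall (F : set (Y * Y)) (E : set (X * X)),
          coarse_entourage F -> coarse_entourage E ->
          F0 `<=` F -> E0 `<=` E ->
          coarse_equivalence (approx_relation U delta F E) /\
          coarse_inverse (approx_relation U delta F E)
                         (approx_relation Ustar delta E F)].
Proof.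
move=> cgX cgY uni [[Tfun _ Tsurj] _ _ _] delta d01.
have d0 : 0 < delta by case/andP: d01.
have uT : transports U Ustar by move=> t /Tfun.
have usT : transports Ustar U.
  (* Surjectivity of [Ad] supplies the transport in the other direction. *)
  move=> s /Tsurj[t at_ <-].
  rewrite (_ : Ad _ _ _ = t)//; apply/funext => x.
  by rewrite /Ad /= !(unitaryK uni).
have uni' := unitary_sym uni.
have [F0 EF0 hF0] := approx_relation_total uni uT cgY usT cgX d01.
(* The same result for the adjoint makes the second projection onto. *)
have [E0 EE0 hE0] := approx_relation_total uni' usT cgX uT cgY d01.
have [_ _ cUX _ _] := coarseP X; have [_ _ cUY _ _] := coarseP Y.
exists (F0 `|` @Edisc Y), (E0 `|` @Edisc X); split.
- exact: cUY EF0 (Edisc_entourage Y).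
- exact: cUX EE0 (Edisc_entourage X).
move=> F E EF EE; rewrite !subUset => -[F0F EdF] [E0E EdE].
have adj := approx_relation_adjoint F E uni d0.
have ctr := approx_relation_controlled uni uT cgY d0 EF EE.
have := approx_relation_controlled uni' usT cgX d0 EE EF; rewrite adj => ctr'.
have tX := hF0 F E F0F EdE.
have tY y : exists x, approx_relation U delta F E (y, x).
  by have := hE0 E F E0E EdF y; rewrite adj.
split; first exact: total_coarse_equivalence ctr ctr' tX tY.
have := total_coarse_inverse ctr ctr' tX tY; rewrite -adj; exact.
Qed.
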